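(* Let $X$ be a proper metric space and let $X=Y\cup Z$, where $Y$ and $Z$ are unbounded closed subsets of $X$ (with the restricted metrics). Then $\operatorname{asInd} X\le\operatorname{asInd} Y+\operatorname{asInd} Z$.
   Context: A metric space $(X,d)$ is proper if every closed ball is compact. A base point $x_0\in X$ is fixed in each (nonempty) proper metric space; $B_r(x)$ is the open ball of radius $r$ around $x$. Distances between sets are infima, with $d(\emptyset,\cdot)=\infty$. Two subsets $A_1,A_2\subset X$ are asymptotically disjoint if $\lim_{r\to\infty} d(A_1\setminus B_r(x_0),A_2\setminus B_r(x_0))=\infty$. A map $\phi:X\to[0,1]$ is slowly oscillating if for every $r>0$ and $\varepsilon>0$ there is $D>0$ such that $\operatorname{diam}\phi(B_r(x))<\varepsilon$ for all $x$ with $d(x,x_0)\ge D$. Let $C_h(X)$ be the set of all continuous slowly oscillating functions $X\to[0,1]$. The Higson compactification $cX$ is the closure of the image of $X$ under the embedding $X\to[0,1]^{C_h(X)}$, $x\mapsto(\phi(x))_{\phi\in C_h(X)}$; the Higson corona is $\nu X=cX\setminus X$. For $C\subset X$ put $C'=\operatorname{cl}_{cX}(C)\cap\nu X$. A partition between disjoint closed subsets $F_1,F_2$ of a topological space $T$ is a subset $P\subset T$ such that $T\setminus P=U_1\cup U_2$ with $U_1,U_2$ disjoint open subsets of $T$, $F_1\subset U_1$, $F_2\subset U_2$. For asymptotically disjoint $A_1,A_2\subset X$, a closed subset $C\subset X$ is an asymptotic separator for $A_1$ and $A_2$ if $C'$ is a partition between $A_1'$ and $A_2'$ in $\nu X$.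 The dimension $\operatorname{asInd}$ is defined for proper metric spaces inductively (closed subsets of proper metric spaces are proper metric spaces with the restricted metric): $\operatorname{asInd}X=-1$ iff $X$ is bounded (the empty set counts as bounded); for an integer $n\ge 0$, $\operatorname{asInd}X\le n$ if for every two asymptotically disjoint sets $A,B\subset X$ there is an asymptotic separator $C$ for $A$ and $B$ with $\operatorname{asInd}C\le n-1$. $\operatorname{asInd}X=n$ if $\operatorname{asInd}X\le n$ and not $\operatorname{asInd}X\le n-1$; $\operatorname{asInd}X=\infty$ if $\operatorname{asInd}X\le n$ holds for no $n$. *)

(* Defs.v *)
From HB Require Import structures.
From mathcomp Require Import all_boot all_order all_algebra.
From mathcomp Require Import all_classical all_reals all_analysis.

Set Implicit Arguments.
Unset Strict Implicit.
Unset Printing Implicit Defensive.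

Import Order.TTheory GRing.Theory Num.Theory.
Import numFieldNormedType.Exports.

Local Open Scope classical_set_scope.
Local Open Scope ring_scope.

(* The restricted metric on a subset A, seen as the type [set_type A]; the
   library already provides the pseudometric structure on that type. *)
Section subspace_metric.
Context {R : realType} {X : metricType R} (A : set X).

Let sub_mdist (x y : A) : R := mdist (set_val x) (set_val y).

Let sub_mdist_ge0 x y : 0 <= sub_mdist x y.
Proof. exact: mdist_ge0. Qed.

Let sub_mdist_positivity x y : sub_mdist x y = 0 -> x = y.
Proof. by move=> /mdist_positivity; exact: val_inj. Qed.

Let sub_ballE (x : A) (d : R) : ball x d = [set y | sub_mdist x y < d].
Proof. by rewrite -initial_ballE ballEmdist. Qed.

HB.instance Definition _ := @PseudoMetric_isMetric.Build R (set_type A)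
  sub_mdist sub_mdist_ge0 sub_mdist_positivity sub_ballE.

End subspace_metric.

Section metric_notions.
Context {R : realType}.

(* Not the library's [closed_ball], which is the closure of the open ball. *)
Definition proper_metric (X : metricType R) : Prop :=
  forall (x : X) (r : R), compact [set y | mdist x y <= r].

Definition metric_bounded (X : metricType R) : Prop :=
  exists M : R, forall x y : X, mdist x y <= M.

Definition diam (X : metricType R) (A : set X) : \bar R :=
  ereal_sup [set (mdist z.1 z.2)%:E | z in A `*` A].

(* ereal_inf set0 = +oo *)
Definition set_dist (X : metricType R) (A B : set X) : \bar R :=
  ereal_inf [set (mdist z.1 z.2)%:E | z in A `*` B].

(* For nonempty X the next two notions do not depend on the base point x0;
   quantifying over it spares a choice, and also covers the empty space. *)
Definition asymp_disjoint (X : metricType R) (A B : set X) : Prop :=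
  forall x0 : X,
    set_dist (A `\` ball x0 r) (B `\` ball x0 r) @[r --> +oo%R] --> +oo%E.

(* R^o is R with its metric `|y - x|. *)
Definition unit_itv : set R^o := [set t | 0 <= t <= 1].

Definition slowly_oscillating (X : metricType R) (phi : X -> unit_itv) : Prop :=
  forall x0 : X, forall r eps : R, 0 < r -> 0 < eps ->
    exists2 D : R, 0 < D &
      forall x : X, D <= mdist x x0 -> (diam (phi @` ball x r) < eps%:E)%E.

Definition higson_functions (X : metricType R) : set (X -> unit_itv) :=
  [set phi | continuous phi /\ slowly_oscillating phi].

End metric_notions.

Arguments higson_functions {R} X.

Section higson.
Context {R : realType} (X : metricType R).

Definition higson_cube : topologicalType :=
  {ptws higson_functions X -> unit_itv (R := R)}.

Definition higson_eval (x : X) : higson_cube := fun phi => set_val phi x.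

Definition higson_compactification : topologicalType :=
  set_type (closure (range higson_eval)).

Definition to_higson (x : X) : higson_compactification :=
  exist _ (higson_eval x) (mem_set (subset_closure (imageT higson_eval x))).

Definition higson_corona : set higson_compactification :=
  ~` range to_higson.

(* C' as a subset of the space [set_type higson_corona]. *)
Definition corona_trace (C : set X) : set higson_corona :=
  set_val @^-1` closure (to_higson @` C).

End higson.

Definition partition_between (T : topologicalType) (F1 F2 P : set T) : Prop :=
  exists U1 U2 : set T,
    [/\ open U1, open U2, U1 `&` U2 = set0, ~` P = U1 `|` U2 &
        F1 `<=` U1 /\ F2 `<=` U2].

Definition asymp_separator (R : realType) (X : metricType R)
    (A1 A2 C : set X) : Prop :=
  closed C /\
  partition_between (corona_trace A1) (corona_trace A2) (corona_trace C).

(* [asInd_lt k X] is asInd X <= k - 1. *)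
Fixpoint asInd_lt (R : realType) (k : nat) (X : metricType R) : Prop :=
  match k with
  | 0%N => metric_bounded X
  | k'.+1 => forall A B : set X, asymp_disjoint A B ->
      exists C : set X, asymp_separator A B C /\ asInd_lt k' (set_type C)
  end.

(* [Negz 0] is -1; nothing has dimension below -1. *)
Definition asInd_le (R : realType) (X : metricType R) (n : int) : Prop :=
  match n with
  | Posz m => asInd_lt m.+1 X
  | Negz 0 => asInd_lt 0 X
  | Negz _ => False
  end.

(* The only n with asInd X <= n but not asInd X <= n - 1, +oo if none exists. *)
Definition asInd (R : realType) (X : metricType R) : \bar int :=
  xget +oo%E [set n%:E | n in [set n | asInd_le X n /\ ~ asInd_le X (n - 1)]].

(* Main.v *)
Require Import Defs.
From mathcomp Require Import all_boot all_order all_algebra.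
From mathcomp Require Import all_classical all_reals all_analysis.
From mathcomp Require Import ring lra.

Set Implicit Arguments.
Unset Strict Implicit.
Unset Printing Implicit Defensive.

Import Order.TTheory GRing.Theory Num.Theory.
Import numFieldNormedType.Exports.

Local Open Scope classical_set_scope.
Local Open Scope ring_scope.

(* For a proper space X, a set C separates A from B in the Higson corona exactly
   when the subsets of X coarsely disjoint from C split, coherently, into two
   families of sets, one around A and one around B (a [coarse_splitting]).  This
   only needs that coarse disjointness of two sets is disjointness of their
   traces, and that the Higson cube is compact Hausdorff.

   The dimension is monotone.  If C separates in E and D lies in E, points of D
   close to C cannot be used as a separator in D, as their distance to C is not
   bounded, and thickening C may raise the dimension.  Instead take a maximal
   subset S of D whose points x are isolated in S at a scale proportional to
   their distance to C: at every fixed scale S is a discrete set together with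
   a set at bounded distance from C, so that asInd S <= asInd C, and by
   maximality S still separates.  The relation between S and C
   ([discretely_coarse]) is no longer an inclusion, but it is stable under this
   construction, which makes an induction possible.

   For the addition theorem, by induction on n = asInd Y: if P separates the
   traces of neighbourhoods of A and B in Y, then P together with the part of Z
   away from A and B separates A from B in X, and the induction hypothesis
   applies to this union.  For n = 0 the separator P is bounded, Y splits into
   two coarsely disjoint parts, these are added to A and to B, and a separator
   in Z of the enlarged sets separates in X. *)

(** * Coarse disjointness *)

Section asymptotic_disjointness.
Context {R : realType}.

Definition bounded_subset (X : metricType R) (S : set X) : Prop :=
  forall x0, exists r, forall x, S x -> mdist x0 x <= r.

Definition coarsely_disjoint (X : metricType R) (A B : set X) : Prop :=
  forall M, bounded_subset [set a | A a /\ exists2 b, B b & mdist a b <= M].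

Context {X : metricType R}.
Implicit Types A B C S T V : set X.

Lemma mdistC (x y : X) : mdist x y = mdist y x.
Proof. exact: metric_sym. Qed.

Lemma bounded_subsetW (x0 : X) S r :
  (forall x, S x -> mdist x0 x <= r) -> bounded_subset S.
Proof.
move=> h x1; exists (mdist x1 x0 + r) => x /h hx.
by have := metric_triangle x1 x0 x; lra.
Qed.

Lemma sub_bounded S T : S `<=` T -> bounded_subset T -> bounded_subset S.
Proof. by move=> ST bT x0; have [r h] := bT x0; exists r => x /ST /h. Qed.

Lemma bounded_setU S T :
  bounded_subset S -> bounded_subset T -> bounded_subset (S `|` T).
Proof.
move=> bS bT x0; have [r h] := bS x0; have [s k] := bT x0.
exists (Num.max r s) => x [/h|/k] hx; rewrite le_max hx ?orbT//.
Qed.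

Lemma bounded_set0 : bounded_subset (set0 : set X).
Proof. by move=> x0; exists 0. Qed.

Lemma bounded_thicken M S : bounded_subset S ->
  bounded_subset [set x | exists2 y, S y & mdist x y <= M].
Proof.
move=> bS x0; have [r h] := bS x0; exists (r + M) => x [y /h hy xy].
by have := metric_triangle x0 y x; rewrite (mdistC y x); lra.
Qed.

Lemma asymp_disjointP A B : asymp_disjoint A B <-> coarsely_disjoint A B.
Proof.
split=> h.
- move=> M x0; have /cvgeyPge/(_ (M + 1)) := h x0.
  move=> /= [r [_ hr]]; have {hr} := hr (r + 1) _; rewrite ltrDl ltr01 => /(_ isT).
  move=> hr; exists (r + 1 + `|M|) => a [Aa [b Bb ab]].
  have ta := metric_triangle x0 b a; rewrite (mdistC b a) in ta.
  have MM := ler_norm M; have M0 := normr_ge0 M.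
  rewrite leNgt; apply/negP => bad.
  have : (set_dist (A `\` ball x0 (r + 1)) (B `\` ball x0 (r + 1)) <= M%:E)%E.
    apply: ge_ereal_inf; exists (mdist a b)%:E; last by rewrite lee_fin.
    exists (a, b) => //=; split; split=> //=; rewrite ballEmdist /=; lra.
  by move=> /(le_trans hr); rewrite lee_fin; lra.
- move=> x0; apply/cvgeyPge => M.
  have [r hr] := h M x0; exists r; split; first exact: num_real.
  move=> s rs /=; apply/ereal_infP => _ [[a b] /= [[Aa na] [Bb nb]] <-].
  rewrite lee_fin leNgt; apply/negP => ab.
  have /hr : [set a | A a /\ exists2 b, B b & mdist a b <= M] a.
    by split=> //; exists b => //; exact: ltW.
  by move: na; rewrite ballEmdist /= => na ?; apply: na; lra.
Qed.

Lemma coarsely_disjointC A B : coarsely_disjoint A B -> coarsely_disjoint B A.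
Proof.
move=> h M; apply: sub_bounded (bounded_thicken M (h M)).
move=> b [Bb [a Aa ab]]; exists a => //; split=> //.
by exists b => //; rewrite mdistC.
Qed.

Lemma sub_coarsely_disjoint A A' B B' : A' `<=` A -> B' `<=` B ->
  coarsely_disjoint A B -> coarsely_disjoint A' B'.
Proof.
move=> sA sB h M; apply: sub_bounded (h M) => a [/sA Aa [b /sB Bb ab]].
by split=> //; exists b.
Qed.

Lemma coarsely_disjoint_setUl A A' B : coarsely_disjoint A B ->
  coarsely_disjoint A' B -> coarsely_disjoint (A `|` A') B.
Proof.
move=> h h' M; apply: sub_bounded (bounded_setU (h M) (h' M)).
by move=> a [[Aa|Aa] Bb]; [left|right].
Qed.

Lemma coarsely_disjoint_setUr A B B' : coarsely_disjoint A B ->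
  coarsely_disjoint A B' -> coarsely_disjoint A (B `|` B').
Proof.
by move=> *; apply/coarsely_disjointC/coarsely_disjoint_setUl;
  exact/coarsely_disjointC.
Qed.

Lemma bounded_coarsely_disjointl A B :
  bounded_subset A -> coarsely_disjoint A B.
Proof. by move=> bA M; apply: sub_bounded bA => a []. Qed.

Lemma bounded_coarsely_disjointr A B :
  bounded_subset B -> coarsely_disjoint A B.
Proof. by move=> *; exact/coarsely_disjointC/bounded_coarsely_disjointl. Qed.

Lemma coarsely_disjoint_setI A B :
  coarsely_disjoint A B -> bounded_subset (A `&` B).
Proof.
move=> h; apply: sub_bounded (h 0) => x [Ax Bx]; split=> //.
by exists x => //; rewrite mdistxx.
Qed.

Lemma coarsely_disjoint_closurel A B :
  coarsely_disjoint A B -> coarsely_disjoint (closure A) B.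
Proof.
move=> h M; apply: sub_bounded (bounded_thicken 1 (h (M + 1))).
move=> x [clx [b Bb xb]].
have [a [Aa]] := clx _ (nbhsx_ballx x 1 ltr01).
rewrite ballEmdist /= => xa; exists a; last exact: ltW.
split=> //; exists b => //; have := metric_triangle a x b.
by rewrite (mdistC a x); lra.
Qed.

Lemma metric_bounded_subset : metric_bounded X <-> bounded_subset [set: X].
Proof.
split=> [[M h] x0|h]; first by exists M.
case: (pselect (exists x : X, True)) => [[x0 _]|nX].
  have [r hr] := h x0; exists (r + r) => x y.
  have := hr x I; have := hr y I; have := metric_triangle x x0 y.
  by rewrite (mdistC x x0); lra.
by exists 0 => x; exfalso; apply: nX; exists x.
Qed.

(** It widens in proportion to the distance to [B]: enough for its complement to be coarsely
    disjoint from [A], while the factor 4 keeps the neighbourhoods of [A] and of [B] coarsely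
    disjoint from each other. *)
Definition nbhd_of A B : set X :=
  [set x | exists2 a, A a & forall b, B b -> 4 * mdist x a <= mdist x b].

Lemma nbhd_of_sub A B : A `<=` nbhd_of A B.
Proof. by move=> a Aa; exists a => // b _; rewrite mdistxx mulr0 mdist_ge0. Qed.

Lemma nbhd_of_compl A B :
  coarsely_disjoint A B -> coarsely_disjoint A (~` nbhd_of A B).
Proof.
move=> h M; apply: sub_bounded (h (5 * M)) => a [Aa [x /= nx ax]].
split=> //; apply: contrapT => nb; apply: nx; exists a => // b Bb.
rewrite leNgt; apply/negP => xb; apply: nb; exists b => //.
by have := metric_triangle a x b; rewrite (mdistC x a) in xb; lra.
Qed.

(** For [x] near [a] and [y] near [b] with [mdist x y <= M], the two defining inequalities add up to
    [3 * (mdist x a + mdist y b) <= 2 * M], so [a] and [b] are close. *)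
Lemma nbhd_of_disjoint A B : coarsely_disjoint A B ->
  coarsely_disjoint (nbhd_of A B) (nbhd_of B A).
Proof.
move=> h M; apply: sub_bounded (bounded_thicken M (h (3 * M))).
move=> x [[a Aa ha] [y [b Bb hb] xy]].
have := ha b Bb; have := hb a Aa; have := metric_triangle x y b.
have := metric_triangle y x a; rewrite (mdistC y x) => t1 t2 e1 e2.
have xy0 := mdist_ge0 x y; have xa : mdist x a <= M by lra.
exists a => //; split=> //; exists b => //.
by have := metric_triangle a x b; rewrite (mdistC a x); lra.
Qed.

End asymptotic_disjointness.

Section splitting.
Context {R : realType} {X : metricType R}.

(* [U1] and [U2] stand for the sets whose traces lie in the two open pieces of
   the complement of the trace of [C].  They are families because the pieces
   need not be induced by two subsets of [X]. *)
Definition coarse_splitting (A B C : set X) (U1 U2 : set (set X)) : Prop :=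
  [/\ forall V1 V2, U1 V1 -> U2 V2 -> coarsely_disjoint V1 V2,
      forall V, coarsely_disjoint V C ->
        exists V1 V2, [/\ U1 V1, U2 V2 & V `<=` V1 `|` V2],
      forall V, U1 V \/ U2 V -> coarsely_disjoint V C,
      U1 A & U2 B].

End splitting.

(** * Partitions of the Higson corona *)

(* [e] is the embedding of [X] in a compactification and [N] its remainder. *)
Section remainder_partition.
Context {R : realType} {X : metricType R} {T : topologicalType}.
Variables (e : X -> T) (N : set T).
Hypotheses (hausT : hausdorff_space T) (compT : compact [set: T]).
Hypotheses (clN : closed N) (subN : N `<=` closure (range e)).

Let cl A := closure (e @` A).

Hypothesis cl_disjoint : forall A B : set X,
  N `&` cl A `&` cl B = set0 <-> coarsely_disjoint A B.

Let cl_disj A B q : coarsely_disjoint A B -> N q -> cl A q -> cl B q -> False.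
Proof. by move=> /cl_disjoint AB Nq Aq Bq; rewrite -[False]/(set0 q) -AB. Qed.

Let cl_sub A B : A `<=` B -> cl A `<=` cl B.
Proof. by move=> AB; exact/closureS/image_subset. Qed.

Let cl_setU A B : cl (A `|` B) = cl A `|` cl B.
Proof. by rewrite /cl image_setU closureU. Qed.

(** If [V] is coarsely disjoint from [C], its trace is covered by [O1] and [O2], and the parts
    outside [O2] and outside [O1] are disjoint closed sets. Normality gives an open [W] around the
    first whose closure misses the second; the preimage of [W] cuts [V] as required. *)
Lemma coarse_splitting_of_open A B C (O1 O2 : set T) : open O1 -> open O2 ->
  N `&` O1 `&` O2 = set0 -> N `\` cl C = N `&` (O1 `|` O2) ->
  N `&` cl A `<=` O1 -> N `&` cl B `<=` O2 ->
  coarse_splitting A B C [set V | N `&` cl V `<=` O1] [set V | N `&` cl V `<=` O2].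
Proof.
move=> oO1 oO2 O12 NC AO BO; split=> //.
- move=> V1 V2 /= V1O V2O; apply/cl_disjoint; rewrite -subset0 -O12.
  by move=> q [[Nq qV1] qV2]; split; [split=> //; exact: V1O|exact: V2O].
- move=> V VC; pose K1 := N `&` cl V `\` O2; pose K2 := N `&` cl V `\` O1.
  have VO : N `&` cl V `<=` O1 `|` O2.
    move=> q [Nq qV]; suff [] : (N `&` (O1 `|` O2)) q by [].
    by rewrite -NC; split=> // qC; exact: cl_disj VC Nq qV qC.
  have clK O : open O -> closed (N `&` cl V `\` O).
    move=> oO; apply: closedI; last exact: open_closedC.
    by apply: closedI => //; exact: closed_closure.
  have nK : set_nbhs K1 (~` K2).
    apply/set_nbhsP; exists (~` K2); split=> //.
      exact/closed_openC/clK.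
    by move=> q [[Nq qV] nO2] [_ nO1]; have [//|//] := VO q (conj Nq qV).
  have [W' /set_nbhsP[W [oW KW WW']] W'K] :=
    compact_normal hausT compT (clK _ oO2) nK.
  have WK := subset_trans (closureS WW') W'K.
  exists (V `&` e @^-1` W), (V `\` e @^-1` W); split.
  + move=> q [Nq qV] /=; have qV' : cl V q by apply: cl_sub qV => ? [].
    have : ~ K2 q.
      by apply: WK; apply: closureS qV => _ [x [_ Wx] <-].
    by move=> nK2; apply: contrapT => nO1; apply: nK2.
  + move=> q [Nq qV] /=; have qV' : cl V q by apply: cl_sub qV => ? [].
    have : (~` W) q.
      have : closed (~` W) by exact: open_closedC.
      move=> /closure_id ->; apply: closureS qV => _ [x [_ nWx] <-] //.
    by move=> nW; apply: contrapT => nO2; apply/nW/KW.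
  + by move=> x Vx; case: (pselect (W (e x))) => Wx; [left|right].
- move=> V VO; apply/cl_disjoint; rewrite -subset0 => q [[Nq qV] qC].
  have : (N `&` (O1 `|` O2)) q.
    by split=> //; case: VO => VO; [left|right]; apply: VO.
  by rewrite -NC => -[_].
Qed.

(** By regularity a point [q] of [N] off [cl C] has a neighbourhood [W] whose preimage is coarsely
    disjoint from [C], hence covered by some [V1] and [V2]. By [subN], [q] lies in [cl V1] or
    [cl V2]; coarse disjointness forbids both, which decides the side of [q]. *)
Lemma open_of_coarse_splitting A B C U1 U2 : coarse_splitting A B C U1 U2 ->
  exists O1 O2 : set T, [/\ open O1, open O2, N `&` O1 `&` O2 = set0,
    N `\` cl C = N `&` (O1 `|` O2) & N `&` cl A `<=` O1 /\ N `&` cl B `<=` O2].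
Proof.
move=> [U12 Usplit UC UA UB].
pose good (W : set T) V1 V2 :=
  [/\ open W, U1 V1, U2 V2 & e @^-1` W `<=` V1 `|` V2].
pose O1 := \bigcup_(z in [set z | good z.1.1 z.1.2 z.2]) (z.1.1 `&` ~` cl z.2).
pose O2 := \bigcup_(z in [set z | good z.1.1 z.1.2 z.2]) (z.1.1 `&` ~` cl z.1.2).
have Wcl W V1 V2 q : good W V1 V2 -> N q -> W q -> cl V1 q \/ cl V2 q.
  move=> [oW _ _ WV] Nq Wq; suff : cl (V1 `|` V2) q by rewrite cl_setU.
  apply: cl_sub WV _ _; move=> D Dq.
  have [_ [[x _ <-] [Dx Wx]]] := subN Nq (filterI Dq (open_nbhs_nbhs (conj oW Wq))).
  by exists (e x); split=> //; exists x.
have cover q : N q -> ~ cl C q -> exists W V1 V2, good W V1 V2 /\ W q.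
  move=> Nq qC.
  have nq : nbhs q (~` cl C).
    by apply: open_nbhs_nbhs; split=> //; apply/closed_openC/closed_closure.
  have [W' + W'C] := compact_regular hausT compT (@filterT _ _ (nbhs_filter q)) nq.
  rewrite nbhsE => -[W [oW Wq] WW'].
  have /Usplit[V1 [V2 [UV1 UV2 WV]]] : coarsely_disjoint (e @^-1` W) C.
    apply/cl_disjoint; rewrite -subset0 => p [[Np pW] pC].
    by apply: (W'C p _ pC); apply: closureS pW => _ [x Wx <-]; exact: WW'.
  by exists W, V1, V2.
have O1cl q : N q -> O1 q -> exists2 V, U1 V & cl V q.
  move=> Nq [[[W V1] V2] /= WV [Wq nV2]]; exists V1; first by case: WV.
  by have [//|/nV2] := Wcl _ _ _ _ WV Nq Wq.
have O2cl q : N q -> O2 q -> exists2 V, U2 V & cl V q.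
  move=> Nq [[[W V1] V2] /= WV [Wq nV1]]; exists V2; first by case: WV.
  by have [/nV1|//] := Wcl _ _ _ _ WV Nq Wq.
have AC : coarsely_disjoint A C by apply: UC; left.
have BC : coarsely_disjoint B C by apply: UC; right.
exists O1, O2; split.
- apply: bigcup_open => -[[W V1] V2] /= [oW _ _ _]; apply: openI => //.
  exact/closed_openC/closed_closure.
- apply: bigcup_open => -[[W V1] V2] /= [oW _ _ _]; apply: openI => //.
  exact/closed_openC/closed_closure.
- rewrite -subset0 => q [[Nq /(O1cl _ Nq)[V1 UV1 qV1]] /(O2cl _ Nq)[V2 UV2 qV2]].
  exact: cl_disj (U12 _ _ UV1 UV2) Nq qV1 qV2.
- apply/seteqP; split=> q [Nq].
  + move=> qC; split=> //; have [W [V1 [V2 [WV Wq]]]] := cover q Nq qC.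
    case: (pselect (cl V2 q)) => qV2; last by left; exists (W, V1, V2).
    right; exists (W, V1, V2) => //; split=> //= qV1.
    by case: WV => _ UV1 UV2 _; exact: cl_disj (U12 _ _ UV1 UV2) Nq qV1 qV2.
  + move=> O12; split=> // qC; case: O12.
      by move=> /(O1cl _ Nq)[V UV qV]; apply: (cl_disj (UC V _)) Nq qV qC; left.
    by move=> /(O2cl _ Nq)[V UV qV]; apply: (cl_disj (UC V _)) Nq qV qC; right.
- split=> q [Nq qA].
  + have [W [V1 [V2 [WV Wq]]]] := cover q Nq (cl_disj AC Nq qA).
    exists (W, V1, V2) => //; split=> //= qV2.
    by case: WV => _ _ UV2 _; exact: cl_disj (U12 _ _ UA UV2) Nq qA qV2.
  + have [W [V1 [V2 [WV Wq]]]] := cover q Nq (cl_disj BC Nq qA).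
    exists (W, V1, V2) => //; split=> //= qV1.
    by case: WV => _ UV1 _ _; exact: cl_disj (U12 _ _ UV1 UB) Nq qV1 qA.
Qed.

End remainder_partition.

(** * Slowly oscillating Urysohn functions *)

Section distance_to_a_set.
Context {R : realType} {X : metricType R}.
Implicit Types (A : set X) (x y : X).

(* [0] when [A] is empty *)
Definition dist_to A x : R := inf [set mdist x a | a in A].

Let has_lb A x : has_lbound [set mdist x a | a in A].
Proof. by exists 0 => _ [a _ <-]; exact: mdist_ge0. Qed.

Lemma dist_to_le A x a : A a -> dist_to A x <= mdist x a.
Proof. by move=> Aa; apply: ge_inf => //; exists a. Qed.

Lemma dist_to_lt A x (eps : R) : A !=set0 -> 0 < eps ->
  exists2 a, A a & mdist x a < dist_to A x + eps.
Proof.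
move=> [a0 Aa0] eps0.
have hi : has_inf [set mdist x a | a in A] by split=> //; exists (mdist x a0), a0.
by have [_ [a Aa <-] ?] := inf_adherent eps0 hi; exists a.
Qed.

Lemma dist_to_ge0 A x : A !=set0 -> 0 <= dist_to A x.
Proof.
move=> [a0 Aa0]; apply: lb_le_inf; first by exists (mdist x a0), a0.
by move=> _ [a _ <-]; exact: mdist_ge0.
Qed.

Lemma dist_to_triangle A x y : A !=set0 -> dist_to A x <= mdist x y + dist_to A y.
Proof.
move=> A0; apply/ler_addgt0Pl => eps eps0.
have [a Aa ya] := dist_to_lt y A0 eps0.
by have := dist_to_le x Aa; have := metric_triangle x y a; lra.
Qed.

Lemma dist_to_in A x : A x -> dist_to A x = 0.
Proof.
move=> Ax; apply/eqP; rewrite eq_le dist_to_ge0; last by exists x.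
by rewrite andbT -(mdistxx x) dist_to_le.
Qed.

End distance_to_a_set.

Section urysohn.
Context {R : realType} {X : metricType R}.
Variables A B : set X.
Hypotheses (A0 : A !=set0) (B0 : B !=set0) (AB : coarsely_disjoint A B).
Hypothesis AB1 : forall a b, A a -> B b -> 1 <= mdist a b.

Let s x := dist_to A x + dist_to B x.
Let f x := dist_to A x / s x.

Let s_ge1 x : 1 <= s x.
Proof.
apply/ler_addgt0Pl => eps eps0; have eps2 : 0 < eps / 2 by rewrite divr_gt0.
have [a Aa xa] := dist_to_lt x A0 eps2; have [b Bb xb] := dist_to_lt x B0 eps2.
have := metric_triangle a x b; rewrite (mdistC a x).
by have := AB1 Aa Bb; rewrite /s; lra.
Qed.

Let s_gt0 x : 0 < s x. Proof. by have := s_ge1 x; lra. Qed.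

Let f01 x : 0 <= f x <= 1.
Proof.
rewrite divr_ge0 ?dist_to_ge0 ?(ltW (s_gt0 x))//= ler_pdivrMr// mul1r /s.
by rewrite lerDl dist_to_ge0.
Qed.

(* Since [s] tends to infinity, this is what makes [f] slowly oscillating. *)
Let f_lip x y : `|f x - f y| <= mdist x y / s y.
Proof.
have -> : f x - f y = (dist_to A x * (dist_to B y - dist_to B x)
    + dist_to B x * (dist_to A x - dist_to A y)) / s x / s y.
  have := s_gt0 x; have := s_gt0 y; rewrite /f /s => sx sy; field.
  by rewrite !gt_eqF.
rewrite normrM (ger0_norm (x := (s y)^-1)) ?invr_ge0 ?(ltW (s_gt0 _))//.
rewrite ler_wpM2r ?invr_ge0 ?(ltW (s_gt0 _))//.
rewrite normrM (ger0_norm (x := (s x)^-1)) ?invr_ge0 ?(ltW (s_gt0 _))//.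
rewrite ler_pdivrMr// (le_trans (ler_normD _ _))// !normrM /s mulrDr.
have dA := dist_to_ge0 x A0; have dB := dist_to_ge0 x B0.
rewrite !(ger0_norm (x := dist_to _ x))// ![mdist x y * _]mulrC.
apply: lerD; apply: ler_wpM2l => //; rewrite ler_norml.
  have := dist_to_triangle x y B0; have := dist_to_triangle y x B0.
  by rewrite (mdistC y x) => *; apply/andP; split; lra.
have := dist_to_triangle x y A0; have := dist_to_triangle y x A0.
by rewrite (mdistC y x) => *; apply/andP; split; lra.
Qed.

Let s_large M : bounded_subset [set x | s x <= M].
Proof.
apply: sub_bounded (bounded_thicken (M + 2) (AB (M + 2))) => x /= sM.
have [a Aa xa] := dist_to_lt x A0 (@ltr01 R).
have [b Bb xb] := dist_to_lt x B0 (@ltr01 R).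
have := dist_to_ge0 x A0; have := dist_to_ge0 x B0; move: sM; rewrite /s => *.
exists a; last by lra.
split=> //; exists b => //.
by have := metric_triangle a x b; rewrite (mdistC a x); lra.
Qed.

Let phi (x : X) : unit_itv (R := R) := exist _ (f x : R^o) (mem_set (f01 x)).

Let phi_continuous : continuous phi.
Proof.
move=> x; apply/metricType_numDomainType.cvgrPdist_lt => eps eps0; near=> y.
apply: (@le_lt_trans _ _ (mdist y x)); last first.
  by near: y; apply/metricType_numDomainType.nbhs_mdistP; exists eps => //= y; rewrite mdistC.
rewrite (_ : mdist _ _ = `|f y - f x|)//.
apply: (le_trans (f_lip y x)); rewrite ler_pdivrMr// ler_peMr ?mdist_ge0//.
Unshelve. all: by end_near. Qed.

Let phi_slow : slowly_oscillating phi.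
Proof.
move=> x0 r eps r0 eps0.
have [D hD] := s_large (4 * r / eps) x0.
exists (`|D| + r + 1); first by have := normr_ge0 D; lra.
move=> x xD; apply: (@le_lt_trans _ _ (eps / 2)%:E); last first.
  by rewrite lte_fin ltr_pdivrMr// ltr_pMr// ltrDl.
apply/ereal_supP => _ [[u v] /= [[y xy <-] [z xz <-]] <-].
rewrite lee_fin (_ : mdist _ _ = `|f z - f y|)//.
apply: (le_trans (f_lip z y)); move: xy xz; rewrite !ballEmdist /= => xy xz.
have sy : 4 * r / eps < s y.
  rewrite ltNge; apply/negP => /hD; have := ler_norm D.
  have := metric_triangle x0 y x; rewrite (mdistC y x) (mdistC x0 x); lra.
rewrite ler_pdivrMr//; move: sy; rewrite ltr_pdivrMr// => sy.
by have := metric_triangle z x y; rewrite (mdistC z x); lra.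
Qed.

(** The function is [f]. Coarse disjointness makes it oscillate slowly; [AB1] bounds its denominator
    below by 1, which gives continuity. *)
Lemma higson_urysohn : exists phi : higson_functions X,
  (forall a, A a -> \val (\val phi a) = 0) /\
  (forall b, B b -> \val (\val phi b) = 1).
Proof.
have Hphi : higson_functions X phi by split.
exists (exist _ phi (mem_set Hphi)); split=> [a Aa|b Bb] /=.
  by rewrite /f dist_to_in// mul0r.
rewrite /f /s (dist_to_in Bb) addr0 divff// gt_eqF//.
by have := s_gt0 b; rewrite /s (dist_to_in Bb) addr0.
Qed.

End urysohn.

(** * The Higson cube and the remainder of [X] in it *)

Lemma compact_set_type (T : topologicalType) (A : set T) :
  compact A -> compact [set: set_type A].
Proof.
move=> cA F FF _.
have FA : F (set_val @^-1` A) by apply: filterE => x; exact: set_valP.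
have [p [Ap clp]] := cA (set_val @ F) _ FA.
exists (exist _ p (mem_set Ap)); split=> // B D FB.
move=> [_ [[W oW <-] Wp WD]].
have FB' : F (set_val @^-1` (set_val @` B)).
  by apply: filterS FB; exact: preimage_image.
have [_ [[x Bx <-] Wx]] := clp _ _ FB' (open_nbhs_nbhs (conj oW Wp)).
by exists x; split=> //; exact: WD.
Qed.

Lemma ptws_cvgP (U : choiceType) (V : topologicalType)
    (F : set_system (U -> V)) (f : U -> V) : Filter F ->
  {ptws, F --> f} <-> forall t : U, (fun g => g t) @ F --> f t.
Proof.
move=> FF; rewrite cvg_sup; split.
  move=> + t => /(_ t).
  rewrite cvg_image; last by rewrite eqEsubset; split=> v // _; exists (cst v).
  apply: cvg_trans => W /=; rewrite ?nbhs_simpl /fmap /= => [[W' + <-]].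
  by apply: filterS => g W'g /=; exists g.
move=> + t => /(_ t).
rewrite cvg_image; last by rewrite eqEsubset; split=> v // _; exists (cst v).
move=> + W //=; rewrite ?nbhs_simpl => Q => /Q Q'; exists (@^~ t @^-1` W) => //.
by rewrite eqEsubset; split => [j [? + <-//]|j Wj]; exists (fun _ => j).
Qed.

Section cube.
Context {R : realType} (X : metricType R).

Lemma unit_itv_compact : compact [set: unit_itv (R := R)].
Proof.
apply: compact_set_type.
have -> : unit_itv = `[(0 : R), 1]%classic.
  by apply/seteqP; split=> x; rewrite /unit_itv /= in_itv.
exact: segment_compact.
Qed.

Lemma higson_cube_compact : compact [set: higson_cube X].
Proof.
have := @tychonoff (higson_functions X) (fun=> unit_itv (R := R)) (fun=> setT)
  (fun=> unit_itv_compact).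
by congr compact; apply/seteqP; split.
Qed.

Lemma higson_cube_hausdorff : hausdorff_space (higson_cube X).
Proof. by apply: hausdorff_product => _; exact: metric_hausdorff. Qed.

Lemma higson_eval_continuous : continuous (@higson_eval R X).
Proof.
move=> x; apply/ptws_cvgP => phi.
by have [+ _] := set_mem (valP phi); exact.
Qed.

Lemma higson_coord_continuous (phi : higson_functions X) :
  continuous (fun q : higson_cube X => \val (q phi) : R).
Proof.
move=> q; apply: (@continuous_comp _ _ _ (fun q : higson_cube X => q phi) set_val).
  by have /ptws_cvgP/(_ phi) : (q : higson_cube X) --> q by exact: cvg_id.
exact: initial_continuous.
Qed.

Definition remainder : set (higson_cube X) :=
  closure (range (@higson_eval R X)) `\` range (@higson_eval R X).

Local Notation cl A := (closure (@higson_eval R X @` A)).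

Lemma higson_coord_closure (phi : higson_functions X) (A : set X) (c : R) q :
  (forall a, A a -> \val (\val phi a) = c) -> cl A q -> \val (q phi) = c.
Proof.
move=> Ac qA.
have cc : closed [set q : higson_cube X | (\val (q phi) : R) = c].
  apply: (@closed_comp _ _ _ [set c]); last exact: closed_eq.
  by move=> p _; exact: higson_coord_continuous.
suff : closure [set q : higson_cube X | (\val (q phi) : R) = c] q.
  by rewrite -(closure_id _).1.
by apply: closureS qA => _ [a /Ac <- <-].
Qed.

(** The Urysohn function is a coordinate of the cube, equal to 0 on one closure and to 1 on the
    other. The uniform gap makes this valid at points of [X] too, not only in the remainder. *)
Lemma coarsely_disjoint_closure (A B : set X) q : coarsely_disjoint A B ->
  (forall a b, A a -> B b -> 1 <= mdist a b) -> cl A q -> cl B q -> False.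
Proof.
move=> AB AB1 qA qB.
case: (pselect (A !=set0)) => [A0|nA]; last first.
  by have [_ [[x Ax _] _]] := qA setT filterT; case: nA; exists x.
case: (pselect (B !=set0)) => [B0|nB]; last first.
  by have [_ [[x Bx _] _]] := qB setT filterT; case: nB; exists x.
have [phi [phiA phiB]] := higson_urysohn A0 B0 AB AB1.
have := higson_coord_closure phiA qA; rewrite (higson_coord_closure phiB qB).
by move=> /eqP; rewrite oner_eq0.
Qed.

Hypothesis properX : proper_metric X.

Lemma remainder_far x0 r :
  remainder `<=` cl [set x | r <= mdist x0 x].
Proof.
move=> q [].
have -> : range (@higson_eval R X) = higson_eval (X := X) @` [set x | mdist x0 x <= r]
   `|` higson_eval (X := X) @` [set x | r <= mdist x0 x].
  rewrite -image_setU; congr (_ @` _); apply/seteqP; split=> // x _ /=.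
  by apply/orP; exact: le_total.
rewrite closureU => -[|//] qB nq; exfalso; apply: nq; left.
rewrite -[X in X q](closure_id _).1 in qB => //; apply: compact_closed => //.
  exact: higson_cube_hausdorff.
apply: continuous_compact; last exact: properX.
by apply: continuous_subspaceT; exact: higson_eval_continuous.
Qed.

Lemma remainder_bounded (A : set X) q :
  bounded_subset A -> remainder q -> cl A q -> False.
Proof.
move=> bA Nq qA.
have [x0 _] : exists x0 : X, True.
  by have [_ [[x _ _] _]] := qA setT filterT; exists x.
have [r hr] := bA x0; have qr := remainder_far x0 (r + 1) Nq.
apply: coarsely_disjoint_closure qA qr; first exact: bounded_coarsely_disjointl.
by move=> a b /hr ar /= br; have := metric_triangle x0 a b; lra.
Qed.

(** This form shows that [remainder] is closed. A point [x] of [X] is excluded since it has distance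
    at least 1 to all points beyond radius [mdist x0 x + 1]. *)
Lemma remainderE x0 :
  remainder = \bigcap_r cl [set x | r <= mdist x0 x].
Proof.
apply/seteqP; split=> [q Nq r _|q qr]; first exact: remainder_far.
split; first by apply: closureS (qr 0 I) => _ [x _ <-]; exists x.
move=> [x _ xq]; have := qr (mdist x0 x + 1) I.
have : cl [set x] q by apply: subset_closure; exists x.
apply: coarsely_disjoint_closure.
  apply: bounded_coarsely_disjointl; apply: (@bounded_subsetW _ _ x _ 0).
  by move=> _ ->; rewrite mdistxx.
by move=> _ b -> /= xb; have := metric_triangle x0 x b; lra.
Qed.

Lemma remainder_closed : closed remainder.
Proof.
case: (pselect (exists x0 : X, True)) => [[x0 _]|nX].
  by rewrite (remainderE x0); apply: closed_bigI => r _; exact: closed_closure.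
suff -> : remainder = set0 by exact: closed0.
rewrite -subset0 => q [qr _].
by have [_ [[x _ _] _]] := qr setT filterT; apply: nX; exists x.
Qed.

(** If pairs from [A] and [B] at distance at most [M] escape to infinity, slow oscillation forces
    both members to the same limit, a common point of the traces. Conversely, the part of [A] within
    1 of [B] is bounded, and a Urysohn function separates the rest from [B]. *)
Lemma remainder_disjointP (A B : set X) :
  remainder `&` cl A `&` cl B = set0 <-> coarsely_disjoint A B.
Proof.
split=> [AB0 M x0|AB].
  apply: contrapT => nb.
  have /choice[ab abP] : forall n : nat, exists ab : X * X,
      [/\ A ab.1, B ab.2, mdist ab.1 ab.2 <= M & n%:R <= mdist x0 ab.1].
    move=> n; apply: contrapT => nab; apply: nb; exists n%:R.
    move=> a [Aa [b Bb ab]]; rewrite leNgt; apply/negP => na; apply: nab.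
    by exists (a, b); split=> //; exact: ltW.
  (* Sequences in the compact cube may lack convergent subsequences, so limits are taken along an
     ultrafilter on the indices. *)
  have [G [GU sG]] := ultraFilterLemma eventually_filter.
  have GP : ProperFilter G by exact: ultra_proper.
  pose u n := higson_eval (ab n).1; pose v n := higson_eval (ab n).2.
  have [q [_ qu]] := 
    higson_cube_compact (fmap_proper_filter u GP) filterT.
  have uq : u @ G --> q.
    move=> W Wq; have [//|nW] := in_ultra_setVsetC (u @^-1` W) GU.
    by have [p []] := qu (~` W) W nW Wq.
  have far_ab r : G [set n | r <= mdist x0 (ab n).1].
    apply: sG; exists (Num.truncn `|r|).+1 => // n /= rn.
    have [_ _ _] := abP n; apply: le_trans; apply: (le_trans (ler_norm r)).
    by apply: ltW; apply: (lt_le_trans (truncnS_gt _)); rewrite ler_nat.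
  have vphi phi : (fun n => v n phi) @ G --> q phi.
    apply/metricType_numDomainType.cvgrPdist_lt => eps eps0.
    have uphi : (fun n => u n phi) @ G --> q phi by move/ptws_cvgP : uq; exact.
    have [_ slow] := set_mem (valP phi).
    have eps2 : 0 < eps / 2 by rewrite divr_gt0.
    have M1 : 0 < `|M| + 1 by have := normr_ge0 M; lra.
    have [D D0 hD] := slow x0 _ _ M1 eps2.
    have near_q : G [set n | mdist (q phi) (u n phi) < eps / 2].
      exact: metricType_numDomainType.cvgr_dist_lt uphi _ eps2.
    suff : G [set n | mdist (q phi) (v n phi) < eps] by [].
    apply: filterS2 (far_ab D) near_q => n /= Dn qn.
    apply: le_lt_trans (metric_triangle _ (u n phi) _) _.
    rewrite [ltRHS]splitr; apply: ltrD => //.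
    rewrite -lte_fin; apply: le_lt_trans (hD (ab n).1 _); last by rewrite mdistC.
    have [_ _ abM _] := abP n; apply: ereal_sup_ubound.
    exists (u n phi, v n phi) => //; split=> /=.
      by exists (ab n).1 => //; rewrite ballEmdist /= mdistxx.
    exists (ab n).2 => //; rewrite ballEmdist /=.
    by have := ler_norm M; lra.
  have vq : v @ G --> q by apply/ptws_cvgP => phi; exact: vphi.
  have cl_lim (w : nat -> X) (S : set X) : (fun n => higson_eval (w n)) @ G --> q ->
      G [set n | S (w n)] -> cl S q.
    move=> wq GS W Wq; have GW : G [set n | W (higson_eval (w n))] by exact: wq Wq.
    have [n [Sn Wn]] := filter_ex (filterI GS GW).
    by exists (higson_eval (w n)); split=> //; exists (w n).
  suff : (remainder `&` cl A `&` cl B) q by rewrite AB0.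
  split; first split.
  - rewrite (remainderE x0) => r _.
    exact: (cl_lim (fun n => (ab n).1) _ uq (far_ab r)).
  - apply: (cl_lim (fun n => (ab n).1)) => //.
    by apply: filterE => n /=; case: (abP n).
  - apply: (cl_lim (fun n => (ab n).2)) => //.
    by apply: filterE => n /=; case: (abP n).
rewrite -subset0 => q [[Nq qA] qB].
pose far := [set a | A a /\ forall b, B b -> 1 < mdist a b].
have : cl (far `|` (A `\` far)) q.
  apply: closureS qA; apply: image_subset => a Aa.
  by case: (pselect (far a)) => ?; [left|right].
rewrite image_setU closureU => -[qfar|]; last first.
  apply: remainder_bounded Nq; apply: sub_bounded (AB 1) => a [Aa nfar].
  split=> //; apply: contrapT => nb; apply: nfar; split=> // b Bb.
  by rewrite ltNge; apply/negP => ab; apply: nb; exists b.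
apply: coarsely_disjoint_closure qfar qB.
  by apply: sub_coarsely_disjoint AB => // a [].
by move=> a b [_ /[apply]] /ltW.
Qed.

End cube.

Arguments remainder {R} X.

(** * Asymptotic separators as coarse splittings *)

Lemma open_set_type (T : topologicalType) (A : set T) (U : set (set_type A)) :
  open U <-> exists2 O : set T, open O & U = set_val @^-1` O.
Proof.
split=> [|[W oW ->]]; first by move=> [W oW <-]; exists W.
by move: (W) oW; apply/continuousP; exact: initial_continuous.
Qed.

Lemma closure_set_type (T : topologicalType) (A : set T) (S : set (set_type A))
    (x : set_type A) : closure S x <-> closure (set_val @` S) (set_val x).
Proof.
split=> [Sx W /initial_continuous /Sx [y [Sy Wy]]|Sx D].
  by exists (set_val y); split=> //; exists y.
move=> [_ [[W oW <-] Wx WD]].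
have [_ [[y Sy <-] Wy]] := Sx _ (open_nbhs_nbhs (conj oW Wx)).
by exists y; split=> //; exact: WD.
Qed.

Section separators.
Context {R : realType} (X : metricType R).

Let corona_pt (q : set_type (@higson_corona R X)) : higson_cube X :=
  set_val (set_val q).

Let corona_pt_remainder q : remainder X (corona_pt q).
Proof.
split; first exact: set_valP.
move=> [x _ xq]; apply: (set_valP q); exists x => //.
exact: val_inj.
Qed.

Let remainder_corona_pt p : remainder X p -> exists q, corona_pt q = p.
Proof.
move=> [clp np]; pose p' : higson_compactification X := exist _ p (mem_set clp).
have Kp : higson_corona p'.
  by move=> [x _ /(congr1 \val) xp]; apply: np; exists x.
by exists (exist _ p' (mem_set Kp)).
Qed.

Let open_corona U :
  open U <-> exists2 O : set (higson_cube X), open O & U = corona_pt @^-1` O.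
Proof.
split=> [/open_set_type[V /open_set_type[W oW ->] ->]|[W oW ->]].
  by exists W.
apply/open_set_type; exists (set_val @^-1` W) => //.
by apply/open_set_type; exists W.
Qed.

Let corona_traceE C q :
  corona_trace C q <-> closure (@higson_eval R X @` C) (corona_pt q).
Proof.
rewrite /corona_trace /= closure_set_type.
suff -> : set_val @` (@to_higson R X @` C) = @higson_eval R X @` C by [].
by rewrite image_comp.
Qed.

(** Through [corona_pt], open sets and traces in the corona are restrictions of open sets and
    closures in the cube, so the two lemmas on a general remainder apply. *)
Lemma asymp_separatorP (A B C : set X) : proper_metric X ->
  asymp_separator A B C <->
  closed C /\ exists U1 U2, coarse_splitting A B C U1 U2.
Proof.
move=> properX.
have hausT := @higson_cube_hausdorff _ X; have compT := @higson_cube_compact _ X.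
have subN : remainder X `<=` closure (range (@higson_eval R X)) by move=> ? [].
have disj := remainder_disjointP properX; have clN := remainder_closed properX.
split=> -[clC]; last first.
  move=> [U1 [U2 U12]]; split=> //.
  have [G1 [G2 [oG1 oG2 G12 NC [AO BO]]]] :=
    open_of_coarse_splitting hausT compT subN disj U12.
  exists (corona_pt @^-1` G1), (corona_pt @^-1` G2); split.
  - by apply/open_corona; exists G1.
  - by apply/open_corona; exists G2.
  - rewrite -subset0 => q [G1q G2q].
    suff : (remainder X `&` G1 `&` G2) (corona_pt q) by rewrite G12.
    by split=> //; split.
  - apply/seteqP; split=> q /=.
      move=> nC; have : (remainder X `\` closure (@higson_eval R X @` C)) (corona_pt q).
        by split=> // /corona_traceE.
      by rewrite NC => -[].
    move=> O12q /corona_traceE Cq.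
    have : (remainder X `&` (G1 `|` G2)) (corona_pt q) by split.
    by rewrite -NC => -[].
  - by split=> q /corona_traceE qA; [apply: AO|apply: BO]; split.
move=> [_ [_ [/open_corona[G1 oG1 ->] /open_corona[G2 oG2 ->] G12 NC [AO BO]]]].
split=> //; do 2 eexists.
apply: (coarse_splitting_of_open hausT compT clN disj oG1 oG2).
- rewrite -subset0 => p [[/remainder_corona_pt[q <-] qO1] qO2].
  suff : (corona_pt @^-1` G1 `&` corona_pt @^-1` G2) q by rewrite G12.
  by [].
- apply/seteqP; split=> p [/remainder_corona_pt[q <-]] => [qC|qO].
    split=> //.
    suff : (corona_pt @^-1` G1 `|` corona_pt @^-1` G2) q by [].
    by rewrite -NC => /corona_traceE.
  split=> // /corona_traceE.
  suff : (~` corona_trace C) q by [].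
  by rewrite NC.
- by move=> p [/remainder_corona_pt[q <-] qA]; apply: AO; apply/corona_traceE.
- by move=> p [/remainder_corona_pt[q <-] qB]; apply: BO; apply/corona_traceE.
Qed.

End separators.

(** Separation concerns two points at a time, so it passes to unions of chains and Zorn's lemma
    applies. As [r] may fail to be symmetric, maximality only says that one of the two orders
    fails. *)
Lemma maximal_separated_subset (T : Type) (G : set T) (r : T -> T -> Prop) :
  exists D : set T, [/\ D `<=` G,
    forall x y, D x -> D y -> x <> y -> r x y &
    forall x, G x -> ~ D x -> exists2 y, D y & x <> y /\ ~ (r x y /\ r y x)].
Proof.
pose P (D : set T) := D `<=` G /\ forall x y, D x -> D y -> x <> y -> r x y.
have [|D [[DG Dr] Dmax]] := @Zorn_bigcup T P.
  move=> F FP totF; split=> [x [D FD Dx]|x y [D FD Dx] [D' FD' D'y] xy].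
    by have [DG _] := FP _ FD; exact: DG.
  have [_ rD] := FP _ FD; have [_ rD'] := FP _ FD'.
  by case: (totF _ _ FD FD') => s; [apply: rD' => //; apply: s|apply: rD => //; apply: s].
exists D; split=> // x Gx nDx; apply: contrapT => nex.
have rx y : D y -> x <> y -> r x y /\ r y x.
  by move=> Dy xy; apply: contrapT => nr; apply: nex; exists y.
apply: (Dmax (D `|` [set x])).
  by split=> [|/(_ x) Dx]; [exact: subsetUl|apply/nDx/Dx; right].
split=> [y [/DG//|->//]|y z [Dy|->] [Dz|->] // yz].
- exact: Dr.
- by have [] := rx y Dy (nesym yz).
- by have [] := rx z Dz yz.
Qed.

(** * Coarse notions in subspaces and first properties of [asInd_lt] *)

Section subspace.
Context {R : realType} {X : metricType R} (A : set X).

Lemma mdist_set_val (x y : set_type A) : mdist x y = mdist (set_val x) (set_val y).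
Proof. by []. Qed.

Lemma bounded_set_val (S : set (set_type A)) :
  bounded_subset S <-> bounded_subset (set_val @` S).
Proof.
split=> [bS|bS x0]; last first.
  by have [r hr] := bS (set_val x0); exists r => x Sx; apply: hr; exists x.
case: (pselect (exists x0 : set_type A, True)) => [[x0 _]|nA].
  have [r hr] := bS x0; apply: (bounded_subsetW (x0 := set_val x0) (r := r)).
  by move=> _ [x /hr xr <-].
by apply: sub_bounded (@bounded_set0 _ _) => _ [x _ <-]; case: nA; exists x.
Qed.

Lemma coarsely_disjoint_set_val (S T : set (set_type A)) :
  coarsely_disjoint S T <-> coarsely_disjoint (set_val @` S) (set_val @` T).
Proof.
split=> h M.
  move/bounded_set_val : (h M); apply: sub_bounded.
  by move=> _ [[x Sx <-] [_ [y Ty <-] xy]]; exists x => //; split=> //; exists y.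
apply/bounded_set_val; apply: sub_bounded (h M) => _ [x [Sx [y Ty xy]] <-].
by split; [exists x|exists (set_val y) => //; exists y].
Qed.

Lemma coarsely_disjoint_preimage_val (S T : set X) : coarsely_disjoint S T ->
  coarsely_disjoint (set_val @^-1` S : set (set_type A)) (set_val @^-1` T).
Proof.
by move=> ST; apply/coarsely_disjoint_set_val; apply: sub_coarsely_disjoint ST;
  move=> _ [x Sx <-].
Qed.

Lemma proper_set_type : closed A -> proper_metric X -> proper_metric (set_type A).
Proof.
move=> clA pX x r F FF FB.
pose B := A `&` [set y | mdist (set_val x) y <= r].
have cB : compact B by rewrite /B setIC; apply: compact_closedI; [exact: pX|].
have FB' : F (set_val @^-1` B).
  by apply: filterS FB => y /= ?; split=> //; exact: set_valP.
have [p [[Ap pr] clp]] := cB (set_val @ F) _ FB'.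
exists (exist _ p (mem_set Ap)); split=> // S D FS.
move=> [_ [[W oW <-] Wp WD]].
have FS' : F (set_val @^-1` (set_val @` S)).
  by apply: filterS FS; exact: preimage_image.
have [_ [[y Sy <-] Wy]] := clp _ _ FS' (open_nbhs_nbhs (conj oW Wp)).
by exists y; split=> //; exact: WD.
Qed.

End subspace.

Section bounded_dimension.
Context {R : realType}.

Lemma asymp_separator_set0 (X : metricType R) (A B : set X) :
  proper_metric X -> metric_bounded X -> asymp_separator A B set0.
Proof.
move=> pX /metric_bounded_subset bX; apply/asymp_separatorP => //.
split; first exact: closed0.
have bnd (V : set X) : bounded_subset V by apply: sub_bounded bX.
exists setT, setT; split=> // [V1 V2 _ _|V _|V _].
- exact: bounded_coarsely_disjointl.
- by exists V, V; split=> // x; left.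
- exact: bounded_coarsely_disjointl.
Qed.

Lemma asInd_ltS k (X : metricType R) :
  proper_metric X -> asInd_lt k X -> asInd_lt k.+1 X.
Proof.
elim: k X => [|k IH] X pX.
  move=> bX A B _; exists set0; split; first exact: asymp_separator_set0.
  by exists 0 => -[x x0]; move/set_mem: (x0).
move=> dX A B /dX[C [sepC dC]]; exists C; split=> //.
by apply: IH dC; apply: proper_set_type => //; case: sepC.
Qed.

Lemma asInd_lt_leq j k (X : metricType R) : (j <= k)%N ->
  proper_metric X -> asInd_lt j X -> asInd_lt k X.
Proof.
move=> /subnK <- pX dX; elim: (k - j)%N => [//|n IH].
by rewrite addSn; exact: asInd_ltS.
Qed.

End bounded_dimension.

(** * Monotonicity of the dimension *)

Section discretely_coarse_map.
Context {R : realType}.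

(* [h x] bounds the distortion of [p] at [x]; it may be unbounded, but by the
   fourth condition [x] is then isolated in [D] at the scale of [h x]. *)
Definition discretely_coarse (D E : metricType R) (p : D -> E) (h : D -> R)
    (c : R) : Prop :=
  [/\ forall x, 0 <= h x,
      forall x x', mdist (p x) (p x') <= mdist x x' + h x + h x',
      forall x x', mdist x x' <= mdist (p x) (p x') + h x + h x',
      forall x x', x <> x' -> h x <= c * mdist x x' &
      forall S : set E, bounded_subset S -> bounded_subset (p @^-1` S)].

Variables (D E : metricType R) (p : D -> E) (h : D -> R) (c : R).
Hypotheses (c1 : 1 <= c) (pE : discretely_coarse p h c).

Let h0 x : 0 <= h x. Proof. by case: pE. Qed.
Let p_le x x' : mdist (p x) (p x') <= mdist x x' + h x + h x'.
Proof. by case: pE. Qed.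
Let p_ge x x' : mdist x x' <= mdist (p x) (p x') + h x + h x'.
Proof. by case: pE. Qed.
Let h_le x x' : x <> x' -> h x <= c * mdist x x'. Proof. by case: pE => _ _ _ + _; exact. Qed.
Let p_proper (S : set E) : bounded_subset S -> bounded_subset (p @^-1` S).
Proof. by case: pE => _ _ _ _; exact. Qed.

Let c_ge (x y : D) : 0 <= c * mdist x y - mdist x y.
Proof. by rewrite subr_ge0 ler_peMl ?mdist_ge0. Qed.

(** For distinct points both values of [h] are at most [c] times the distance, so [p] is Lipschitz
    even where [h] is unbounded. *)
Let p_lip x x' : mdist (p x) (p x') <= (1 + 2 * c) * mdist x x'.
Proof.
case: (pselect (x = x')) => [->|xx']; first by rewrite !mdistxx mulr0.
have := h_le xx'; have := h_le (nesym xx'); rewrite (mdistC x' x).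
by have := p_le x x'; lra.
Qed.

Lemma bounded_image_coarse (S : set D) :
  bounded_subset S -> bounded_subset (p @` S).
Proof.
case: (pselect (exists x0 : D, True)) => [[x0 _] bS|nD _].
  have [r hr] := bS x0.
  apply: (bounded_subsetW (x0 := p x0) (r := (1 + 2 * c) * r)) => _ [x /hr xr <-].
  apply: (le_trans (p_lip _ _)); apply: ler_wpM2l => //; have := c1; lra.
apply: sub_bounded (@bounded_set0 _ _) => _ [x _ <-]; case: nD; exists x => //.
Qed.

Lemma coarsely_disjoint_preimage (S T : set E) : coarsely_disjoint S T ->
  coarsely_disjoint (p @^-1` S) (p @^-1` T).
Proof.
move=> ST M; apply: sub_bounded (p_proper (ST ((1 + 2 * c) * M))).
move=> x [Sx [y Ty xy]]; split=> //; exists (p y) => //.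
by apply: (le_trans (p_lip _ _)); apply: ler_wpM2l => //; have := c1; lra.
Qed.

(* [h] tends to infinity on [V], so the points of [V] are more and more isolated
   and the trace of [V] is clopen in the corona. *)
Definition dispersed (V : set D) : Prop :=
  forall M, bounded_subset [set x | V x /\ h x <= M].

Lemma dispersed_disjoint (V W : set D) : dispersed V ->
  (forall x, V x -> ~ W x) -> coarsely_disjoint V W.
Proof.
move=> dV VW M; apply: sub_bounded (dV (c * M)) => x [Vx [y Wy xy]].
split=> //; have xny : x <> y by move=> e; apply: (VW x Vx); rewrite e.
by apply: (le_trans (h_le xny)); apply: ler_wpM2l => //; have := c1; lra.
Qed.

Section pull_back.
Variables A B : set D.
Hypothesis AB : coarsely_disjoint A B.

(* The points of [A] at which [p] is too distorted for their distance to [B];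
   without them the images of [A] and [B] are coarsely disjoint. *)
Definition crowded (A B : set D) : set D :=
  [set a | A a /\ exists2 b, B b & mdist a b < 4 * h a].

Lemma dispersed_crowded (A' B' : set D) :
  coarsely_disjoint A' B' -> dispersed (crowded A' B').
Proof.
move=> AB' M; apply: sub_bounded (AB' (4 * M)) => a [[Aa [b Bb ab]] ha].
by split=> //; exists b => //; lra.
Qed.

Let Af := A `\` crowded A B.
Let Bf := B `\` crowded B A.

(** For uncrowded [a] and [b] the factor 4 gives [h a + h b <= mdist a b / 2], so [p_ge] bounds
    [mdist a b] by twice the distance of the images. *)
Lemma coarsely_disjoint_uncrowded : coarsely_disjoint (p @` Af) (p @` Bf).
Proof.
move=> M; apply: sub_bounded (bounded_image_coarse (AB (2 * M))).
move=> _ [[a [Aa na] <-] [_ [b [Bb nb] <-] pab]]; exists a => //; split=> //.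
exists b => //; have := p_ge a b.
have : 4 * h a <= mdist a b.
  by rewrite leNgt; apply/negP => ab; apply: na; split=> //; exists b.
have : 4 * h b <= mdist a b.
  rewrite leNgt mdistC; apply/negP => ab; apply: nb; split=> //; exists a => //.
lra.
Qed.

(** [q] is a nearest-point projection to [C] up to an error of 1. Restricted to the set [S] below,
    [q \o p] is the map with which the induction continues. *)
Variables (C : set E) (U1 U2 : set (set E)) (q : E -> E) (y0 : E).
Hypothesis splitC : coarse_splitting (p @` Af) (p @` Bf) C U1 U2.
Hypothesis qC : C !=set0 -> forall y, C (q y).
Hypothesis q_near : forall y z, C z -> mdist y (q y) <= mdist y z + 1.

(* With [y0] in [P], the definition of [G] bounds [h2] by the distance to [y0], so
   that [q \o p] is proper on [G]. *)
Let P := p @` Af `|` p @` Bf `|` [set y0].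
(** Chosen for [S_dense]: if [h2 x < 2 * c * d], with [d] the distance from [x] to [x'], then
    [h2_lip] gives [h2 x' < (4 * c + 1 + 2 * c) * d]. *)
Let K := 6 * c + 1.
Let e x := mdist (p x) (q (p x)).
(** This bounds the distortion of [q \o p] at [x]. The summand 1 makes a set separated at scale [h2]
    uniformly discrete, hence closed. *)
Let h2 x := h x + e x + 1.

Let e0 x : 0 <= e x. Proof. exact: mdist_ge0. Qed.

Let PC : coarsely_disjoint P C.
Proof.
have [_ _ UC UA UB] := splitC.
apply: coarsely_disjoint_setUl; first apply: coarsely_disjoint_setUl.
- by apply: UC; left.
- by apply: UC; right.
- apply: bounded_coarsely_disjointl; apply: (bounded_subsetW (x0 := y0) (r := 0)).
  by move=> _ ->; rewrite mdistxx.
Qed.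

(** Points eligible for the separator: uncrowded, and far from [P] relative to [h2], which keeps the
    separator coarsely disjoint from [A] and [B]. *)
Let G := [set x | [/\ C !=set0, ~ crowded A B x, ~ crowded B A x &
  forall y, P y -> 2 * h2 x <= mdist (p x) y]].
(* Points which [p] brings close to [C] only through its distortion: their images
   say nothing about their side, and being isolated they can go to either. *)
Let I2 := [set x | [/\ C !=set0, ~ G x & e x <= h x]].
Let I := crowded A B `|` crowded B A `|` I2.

Let near_PC M : bounded_subset [set x | exists2 y, P y &
  mdist (p x) y <= M /\ exists2 z, C z & mdist (p x) z <= M].
Proof.
apply: sub_bounded (p_proper (bounded_thicken M (PC (M + M)))).
move=> x [y Py [xy [z Cz xz]]]; exists y => //; split=> //; exists z => //.
by have := metric_triangle y (p x) z; rewrite (mdistC y (p x)); lra.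
Qed.

Let not_G x : C !=set0 -> ~ G x -> ~ crowded A B x -> ~ crowded B A x ->
  exists2 y, P y & mdist (p x) y < 2 * h2 x.
Proof.
move=> C0 nG nA nB; apply: contrapT => ny; apply: nG; split=> // y Py.
by rewrite leNgt; apply/negP => ?; apply: ny; exists y.
Qed.

(** Where [h] is bounded, a point of [I2] maps close to [C] because [e x <= h x], and, unless
    crowded, close to [P] because it is not in [G]. Such points are bounded, as [P] and [C] are
    coarsely disjoint and [p] is proper. *)
Let dispersed_I : dispersed I.
Proof.
have dA := dispersed_crowded AB; have dB := dispersed_crowded (coarsely_disjointC AB).
move=> M; apply: sub_bounded (bounded_setU (bounded_setU (dA M) (dB M))
  (near_PC (4 * M + 2))).
move=> x [Ix hx]; case: (pselect (crowded A B x)) => [?|nA]; first by left; left.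
case: (pselect (crowded B A x)) => [?|nB]; first by left; right.
right; case: Ix => [[//|//]|[C0 nG ex]].
have [y Py xy] := not_G C0 nG nA nB; have := h0 x; rewrite /h2 in xy => hx0.
exists y => //; split; first by lra.
by exists (q (p x)); [exact: qC|rewrite -/(e x); lra].
Qed.

Let h2_lip x x' : C !=set0 -> x <> x' ->
  h2 x' <= 2 * h2 x + (1 + 2 * c) * mdist x x'.
Proof.
move=> C0 xx'; have := q_near (p x') (qC C0 (p x)); rewrite -/(e x').
have := metric_triangle (p x') (p x) (q (p x)); rewrite -/(e x).
have := p_le x' x; rewrite (mdistC x' x) /h2.
have := h_le (nesym xx'); rewrite (mdistC x' x).
by have := h0 x; have := e0 x; lra.
Qed.

Variable S : set D.
Hypothesis SG : S `<=` G.
Hypothesis S_sep : forall x x', S x -> S x' -> x <> x' -> h2 x <= K * mdist x x'.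
Hypothesis S_max : forall x, G x -> ~ S x -> exists2 x', S x' &
  x <> x' /\ ~ (h2 x <= K * mdist x x' /\ h2 x' <= K * mdist x' x).

Let S_dense x : G x -> ~ S x -> exists2 x', S x' &
  x <> x' /\ 2 * (c * mdist x x') <= h2 x.
Proof.
move=> Gx nSx; have [x' Sx' [xx' nsep]] := S_max Gx nSx; exists x' => //.
split=> //; rewrite leNgt; apply/negP => lt_h2; apply: nsep.
have C0 : C !=set0 by case: Gx.
have := h2_lip C0 xx'; rewrite (mdistC x' x) /K => h2l.
have := c_ge x x'; have := mdist_ge0 x x'.
by split; lra.
Qed.

Lemma pull_back_separated_closed : closed S.
Proof.
have K0 : 0 < K by rewrite /K; have := c1; lra.
have S1 x x' : S x -> S x' -> K * mdist x x' < 1 -> x = x'.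
  move=> Sx Sx' xx'; apply: contrapT => /(S_sep Sx Sx').
  by rewrite /h2; have := h0 x; have := e0 x; lra.
have K2 : 0 < (2 * K)^-1 by rewrite invr_gt0; have := K0; lra.
move=> x clx; have [y [Sy]] := clx _ (nbhsx_ballx x _ K2).
rewrite ballEmdist /= => xy; case: (eqVneq x y) => [->//|].
rewrite -mdist_gt0 => xy0.
have [z [Sz]] := clx _ (nbhsx_ballx x _ xy0).
rewrite ballEmdist /= => xz.
suff yz : y = z by move: xz; rewrite yz ltxx.
apply: S1 => //.
have : mdist y z < K^-1.
  have := metric_triangle y x z; rewrite (mdistC y x).
  have -> : K^-1 = (2 * K)^-1 + (2 * K)^-1 by field; rewrite gt_eqF.
  lra.
by rewrite -(ltr_pM2l K0) divff// gt_eqF.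
Qed.

(** Let [x] lie outside [I] with [p x] within [M] of [C]. If [x] is not in [G], then [h x < e x]
    bounds [h2 x], so [p x] is close to [P] as well, which leaves a bounded set. If [x] is in [G]
    but not in [S], [S_dense] gives [x'] in [S] with [2 * (c * mdist x x') <= h2 x]; the term [h x]
    absorbs at most half of this, so [x'] is within [M + 2] of [x]. *)
Let cover (V : set D) : coarsely_disjoint V S ->
  coarsely_disjoint (p @` (V `\` I)) C.
Proof.
move=> VS M; apply: sub_bounded (bounded_image_coarse (bounded_setU (VS (M + 2))
  (near_PC (4 * M + 6)))).
move=> _ [[x [Vx nIx] <-] [z Cz xz]]; exists x => //.
have C0 : C !=set0 by exists z.
have ex : e x <= M + 1 by have := q_near (p x) Cz; rewrite -/(e x); lra.
have xz0 := mdist_ge0 (p x) z.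
have nA : ~ crowded A B x by move=> ?; apply: nIx; left; left.
have nB : ~ crowded B A x by move=> ?; apply: nIx; left; right.
case: (pselect (G x)) => Gx; last first.
  right; have [y Py xy] := not_G C0 Gx nA nB.
  have hx : h x < e x.
    by rewrite ltNge; apply/negP => ?; apply: nIx; right.
  rewrite /h2 in xy; exists y => //; split; first by lra.
  by exists z => //; lra.
left; split=> //; case: (pselect (S x)) => [Sx|nSx].
  by exists x => //; rewrite mdistxx; lra.
have [x' Sx' [xx' xx'h]] := S_dense Gx nSx; exists x' => //.
have := h_le xx'; have := c_ge x x'; rewrite /h2 in xx'h; lra.
Qed.

(** If [s] in [S] is close to [x], the definition of [G] bounds [h2 s] by the distance from [p s] to
    [p x], so [p x] is close to [C] while lying in [P]. *)
Let P_disjoint (T : set D) : (forall x, T x -> P (p x)) -> coarsely_disjoint T S.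
Proof.
move=> TP M; apply: sub_bounded (near_PC (2 * ((1 + 2 * c) * M))) => x [Tx [s Ss xs]].
have [C0 _ _ /(_ _ (TP x Tx))] := SG Ss; rewrite mdistC => sh.
have xsM : mdist (p x) (p s) <= (1 + 2 * c) * M.
  by apply: (le_trans (p_lip _ _)); apply: ler_wpM2l => //; have := c1; lra.
have := mdist_ge0 (p x) (p s) => xs0.
exists (p x); [exact: TP|split; first by rewrite mdistxx; lra].
exists (q (p s)); first exact: qC.
have := metric_triangle (p x) (p s) (q (p s)); rewrite -/(e s).
by have := h0 s; rewrite /h2 in sh; lra.
Qed.

(** Outside [I] the sides are pulled back along [p]; on [I], which is dispersed, any cut will do,
    and [T] cuts by membership in [B]. The bounded set [B0] takes the points common to [A] and [B],
    which this cut may put on the side of [B]. *)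
Let side (U : set (set E)) (T : set D) : set (set D) := [set V |
  coarsely_disjoint V S /\ exists W B0, [/\ U W, bounded_subset B0 &
    V `<=` B0 `|` (p @^-1` W `&` ~` I) `|` (I `&` T)]].

Lemma pull_back_splitting :
  coarse_splitting A B S (side U1 (~` B)) (side U2 B).
Proof.
have [U12 Usplit UC UA UB] := splitC.
have dispI T T' : (forall x, T x -> ~ T' x) -> coarsely_disjoint (I `&` T) T'.
  move=> TT'; apply: dispersed_disjoint; last by move=> x [_ /TT'].
  by move=> M; apply: sub_bounded (dispersed_I M) => x [[]].
have dispIC : coarsely_disjoint I (~` I).
  by apply: dispersed_disjoint => // x Ix nIx; exact: nIx.
split.
- move=> V1 V2 [_ [W1 [B1 [UW1 bB1 VW1]]]] [_ [W2 [B2 [UW2 bB2 VW2]]]].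
  apply: sub_coarsely_disjoint VW1 VW2 _.
  apply: coarsely_disjoint_setUl; first apply: coarsely_disjoint_setUl.
  + exact: bounded_coarsely_disjointl.
  + apply: coarsely_disjoint_setUr; first apply: coarsely_disjoint_setUr.
    * exact: bounded_coarsely_disjointr.
    * by apply: sub_coarsely_disjoint (coarsely_disjoint_preimage (U12 _ _ UW1 UW2))
        => x [].
    * by apply: coarsely_disjointC; apply: sub_coarsely_disjoint dispIC => x [].
  + apply: coarsely_disjoint_setUr; first apply: coarsely_disjoint_setUr.
    * exact: bounded_coarsely_disjointr.
    * by apply: sub_coarsely_disjoint dispIC => x [].
    * by apply: (sub_coarsely_disjoint _ _ (dispI (~` B) B _)) => // x [].
- move=> V VS; have [W1 [W2 [UW1 UW2 VW]]] := Usplit _ (cover VS).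
  exists (V `&` ((p @^-1` W1 `&` ~` I) `|` (I `&` ~` B))).
  exists (V `&` ((p @^-1` W2 `&` ~` I) `|` (I `&` B))).
  split.
  + split; first by apply: sub_coarsely_disjoint VS => // x [].
    by exists W1, set0; split=> //; [exact: bounded_set0|move=> x [_]; rewrite set0U].
  + split; first by apply: sub_coarsely_disjoint VS => // x [].
    by exists W2, set0; split=> //; [exact: bounded_set0|move=> x [_]; rewrite set0U].
  + move=> x Vx; case: (pselect (I x)) => Ix.
      by case: (pselect (B x)) => Bx; [right|left]; split=> //; right.
    have [W1x|W2x] : (W1 `|` W2) (p x) by apply: VW; exists x.
      by left; split=> //; left.
    by right; split=> //; left.
- by move=> V [] [].
- split.
    have -> : A = crowded A B `|` Af.
      apply/seteqP; split=> x; last by case=> -[].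
      by move=> Ax; case: (pselect (crowded A B x)) => ?; [left|right].
    apply: coarsely_disjoint_setUl.
      apply: dispersed_disjoint; first exact: dispersed_crowded.
      by move=> x Ax /SG[].
    by apply: P_disjoint => x Ax; left; left; exists x.
  exists (p @` Af), (A `&` B); split=> //; first exact: coarsely_disjoint_setI.
  move=> x Ax; case: (pselect (I x)) => Ix.
    by case: (pselect (B x)) => Bx; [left; left|right].
  left; right; split=> //; exists x => //; split=> // cx; apply: Ix.
  by left; left.
- split.
    have -> : B = crowded B A `|` Bf.
      apply/seteqP; split=> x; last by case=> -[].
      by move=> Bx; case: (pselect (crowded B A x)) => ?; [left|right].
    apply: coarsely_disjoint_setUl.
      apply: dispersed_disjoint; last by move=> x Bx /SG[].
      exact/dispersed_crowded/coarsely_disjointC.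
    by apply: P_disjoint => x Bx; left; right; exists x.
  exists (p @` Bf), set0; split=> //; first exact: bounded_set0.
  move=> x Bx; case: (pselect (I x)) => Ix; first by right.
  left; right; split=> //; exists x => //; split=> // cx; apply: Ix.
  by left; right.
Qed.
End pull_back.
End discretely_coarse_map.

(** * Induction along discretely coarse maps; separators in subspaces *)

Section induction.
Context {R : realType}.

(** A separator [C] in [E] yields the separator [S] in [D], and [q \o p] from [S] to [C] is again
    discretely coarse, with [h2] for [h] and [6 * c + 1] for [c]. *)
Lemma asInd_lt_discretely_coarse k (D E : metricType R) (p : D -> E) (h : D -> R)
    (c : R) : 1 <= c -> discretely_coarse p h c ->
  proper_metric D -> proper_metric E -> asInd_lt k E -> asInd_lt k D.
Proof.
elim: k D E p h c => [|k IH] D E p h c c1 pE pD pE'.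
  move=> /metric_bounded_subset bE; apply/metric_bounded_subset.
  by case: pE => _ _ _ _ /(_ _ bE); apply: sub_bounded.
move=> dE A B /asymp_disjointP AB.
case: (pselect (exists x0 : D, True)) => [[x0 _]|nD]; last first.
  exists set0; split.
    by apply: asymp_separator_set0 => //; exists 0 => x; case: nD; exists x.
  apply: (@asInd_lt_leq _ 0) => //; first exact: (proper_set_type closed0).
  by exists 0 => -[x xx]; move/set_mem: (xx).
have /asymp_disjointP /dE [C [/(asymp_separatorP _ _ _ pE')[clC [U1 [U2 splitC]]] dC]] :=
  coarsely_disjoint_uncrowded c1 pE AB.
have [q qC] : exists q : E -> E, (C !=set0 -> forall y, C (q y)) /\
    forall y z, C z -> mdist y (q y) <= mdist y z + 1.
  case: (pselect (C !=set0)) => [C0|nC]; last first.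
    by exists id; split=> // y z Cz; case: nC; exists z.
  have /choice[q qP] : forall y, exists z, C z /\ mdist y z <= dist_to C y + 1.
    by move=> y; have [z Cz yz] := dist_to_lt y C0 ltr01; exists z; split=> //; exact: ltW.
  exists q; split=> [_ y|y z Cz]; first by have [] := qP y.
  by have [_] := qP y; have := dist_to_le y Cz; lra.
case: qC => qC q_near.
pose h2 x := h x + mdist (p x) (q (p x)) + 1.
pose P := p @` (A `\` crowded h A B) `|` p @` (B `\` crowded h B A) `|` [set p x0].
pose G := [set x | [/\ C !=set0, ~ crowded h A B x, ~ crowded h B A x &
  forall y, P y -> 2 * h2 x <= mdist (p x) y]].
have [S [SG Ssep Smax]] := maximal_separated_subset G
  (fun x x' => h2 x <= (6 * c + 1) * mdist x x').
have clS := pull_back_separated_closed c1 pE Ssep.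
have splitS := pull_back_splitting c1 pE AB splitC qC q_near SG Smax.
exists S; split.
  by apply/asymp_separatorP => //; split=> //; do 2 eexists; exact: splitS.
have GC (x : set_type S) : C (q (p (set_val x))).
  by have [C0 _ _ _] := SG _ (set_valP x); exact: qC.
pose p2 (x : set_type S) : set_type C := SigSub (mem_set (GC x)).
apply: (IH _ _ p2 (fun x => h2 (set_val x)) (6 * c + 1)) dC; first by lra.
- have [h0 p_le p_ge _ p_proper] := pE; split.
  + move=> x; rewrite /h2; have := h0 (set_val x).
    by have := mdist_ge0 (p (set_val x)) (q (p (set_val x))); lra.
  + move=> x x'; pose y := set_val x; pose y' := set_val x'.
    rewrite -[leLHS]/(mdist (q (p y)) (q (p y'))) mdist_set_val -/y -/y' /h2.
    have := p_le y y'; have := metric_triangle (q (p y)) (p y) (q (p y')).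
    have := metric_triangle (p y) (p y') (q (p y')).
    by rewrite (mdistC (q (p y)) (p y)); lra.
  + move=> x x'; pose y := set_val x; pose y' := set_val x'.
    rewrite -[mdist (p2 x) _]/(mdist (q (p y)) (q (p y'))) mdist_set_val -/y -/y' /h2.
    have := p_ge y y'; have := metric_triangle (p y) (q (p y)) (p y').
    have := metric_triangle (q (p y)) (q (p y')) (p y').
    by rewrite (mdistC (q (p y')) (p y')); lra.
  + move=> x x' xx'; rewrite mdist_set_val; apply: Ssep; try exact: set_valP.
    by move=> /val_inj.
  (* If the projection of [p x] is within [r] of [p x0], then [mdist (p x) (p x0)] is at most
     [h2 x + r]. It is at least [2 * h2 x] because [p x0] is in [P], so it is at most [2 * r]. *)
  + move=> T /bounded_set_val bT; apply/bounded_set_val.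
    have [r hr] := bT (p x0).
    have bp : bounded_subset [set y | mdist (p x0) y <= 2 * r].
      exact: (bounded_subsetW (x0 := p x0) (r := 2 * r)).
    apply: sub_bounded (p_proper _ bp) => _ [x Tx <-] /=.
    have : mdist (p x0) (q (p (set_val x))) <= r by apply: hr; exists (p2 x).
    have : S (set_val x) by exact: set_valP.
    move: (set_val x) => y /SG[_ _ _ /(_ _ (or_intror erefl))].
    rewrite /h2; have := h0 y.
    have := metric_triangle (p y) (q (p y)) (p x0).
    rewrite (mdistC (q (p y)) (p x0)) (mdistC (p x0) (p y)).
    have := mdist_ge0 (p y) (q (p y)); lra.
- exact: proper_set_type.
- exact: proper_set_type.
Qed.

Lemma asInd_lt_isometry k (D E : metricType R) (f : D -> E) :
  (forall x y, mdist (f x) (f y) = mdist x y) ->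
  proper_metric D -> proper_metric E -> asInd_lt k E -> asInd_lt k D.
Proof.
move=> fE pD pE; apply: (@asInd_lt_discretely_coarse k D E f (fun=> 0) 1) => //.
split=> [//|x y|x y|x y _|S bS x0].
- by rewrite fE !addr0.
- by rewrite fE !addr0.
- by rewrite mul1r mdist_ge0.
- by have [r hr] := bS (f x0); exists r => x /hr; rewrite fE.
Qed.

Variable X : metricType R.
Hypothesis properX : proper_metric X.

Lemma asInd_lt_subset k (Y Y' : set X) : closed Y -> closed Y' -> Y `<=` Y' ->
  asInd_lt k (set_type Y') -> asInd_lt k (set_type Y).
Proof.
move=> clY clY' YY'.
pose f (x : set_type Y) : set_type Y' := SigSub (mem_set (YY' _ (set_valP x))).
by apply: (@asInd_lt_isometry _ _ _ f) => //; exact: proper_set_type.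
Qed.

Lemma asInd_lt_preimage k (L Y : set X) : closed L -> closed Y ->
  asInd_lt k (set_type Y) ->
  asInd_lt k (set_type (set_val @^-1` Y : set (set_type L))).
Proof.
move=> clL clY.
pose f (x : set_type (set_val @^-1` Y : set (set_type L))) : set_type Y :=
  SigSub (mem_set (set_valP x : Y (set_val (set_val x)))).
apply: (@asInd_lt_isometry _ _ _ f) => //; last exact: proper_set_type.
apply: proper_set_type; last exact: proper_set_type.
by apply: closed_comp clY => x _; exact: initial_continuous.
Qed.

(** Expresses a separator of the subspace [Y] through subsets of [X], where pieces found in [Y] and
    in [Z] can be combined. *)
Lemma subspace_separator k (Y A B : set X) : closed Y ->
  asInd_lt k.+1 (set_type Y) -> coarsely_disjoint A B ->
  exists C U1 U2, [/\ closed C, C `<=` Y, asInd_lt k (set_type C),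
    [/\ forall V1 V2, U1 V1 -> U2 V2 -> coarsely_disjoint V1 V2,
        forall V, V `<=` Y -> coarsely_disjoint V C ->
          exists V1 V2, [/\ U1 V1, U2 V2 & V `<=` V1 `|` V2] &
        forall V, U1 V \/ U2 V -> V `<=` Y /\ coarsely_disjoint V C] &
    U1 (A `&` Y) /\ U2 (B `&` Y)].
Proof.
move=> clY dY /(@coarsely_disjoint_preimage_val _ _ Y)/asymp_disjointP/dY.
have pY := proper_set_type clY properX.
move=> [C [/(asymp_separatorP _ _ _ pY)[clC [U1 [U2 [U12 Usplit UC UA UB]]]] dC]].
have val_preimage (T : set X) : set_val @` (set_val @^-1` T : set (set_type Y)) = T `&` Y.
  apply/seteqP; split=> [_ [x Tx <-]|x [Tx Yx]]; first by split=> //; exact: set_valP.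
  by exists (SigSub (mem_set Yx)).
have clC' : closed (set_val @` C).
  have [W oW] : exists2 W : set X, open W & ~` C = set_val @^-1` W.
    exact/open_set_type/closed_openC.
  move=> /(congr1 setC); rewrite setCK => ->.
  have -> : ~` (set_val @^-1` W) = set_val @^-1` (~` W) :> set (set_type Y) by [].
  by rewrite val_preimage; apply: closedI => //; exact: open_closedC.
exists (set_val @` C), [set set_val @` V | V in U1], [set set_val @` V | V in U2].
split=> //.
- by move=> _ [x _ <-]; exact: set_valP.
- have Cval (x : set_type (set_val @` C)) : {y : set_type C | set_val (set_val y) = set_val x}.
    apply: cid; have [y Cy yx] := set_valP x.
    by exists (SigSub (mem_set Cy)).
  apply: (@asInd_lt_isometry _ _ _ (fun x => sval (Cval x))) dC.
  + move=> x y; rewrite !mdist_set_val.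
    by rewrite (svalP (Cval x)) (svalP (Cval y)).
  + exact: proper_set_type.
  + exact: proper_set_type.
- split.
  + move=> _ _ [V1 UV1 <-] [V2 UV2 <-]; apply/coarsely_disjoint_set_val.
    exact: U12.
  + move=> V VY VC.
    have [|V1 [V2 [UV1 UV2 VV]]] := Usplit (set_val @^-1` V).
      apply/coarsely_disjoint_set_val; rewrite val_preimage.
      by apply: sub_coarsely_disjoint VC => // x [].
    exists (set_val @` V1), (set_val @` V2); split; [by exists V1|by exists V2|].
    by rewrite -image_setU => x Vx; exists (SigSub (mem_set (VY x Vx))) => //; exact: VV.
  + move=> V UV; have [V' [<- UV']] : exists V', set_val @` V' = V /\ (U1 V' \/ U2 V').
      by case: UV => -[V' UV' <-]; exists V'; split=> //; [left|right].
    split; first by move=> _ [x _ <-]; exact: set_valP.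
    by apply/coarsely_disjoint_set_val; exact: UC.
- by split; rewrite -val_preimage; [exists (set_val @^-1` A)|exists (set_val @^-1` B)].
Qed.

End induction.

(** * The addition theorem *)

Section addition.
Context {R : realType}.

(** The complement of [nbhd_of A B] is already coarsely disjoint from [A]. Thus separating
    neighbourhoods inside [Y] controls all of [A], including its points outside [Y]. *)
Lemma coarsely_disjoint_nbhd (X : metricType R) (A B V : set X) :
  coarsely_disjoint A B -> bounded_subset (nbhd_of A B `&` V) ->
  coarsely_disjoint A V.
Proof.
move=> /nbhd_of_compl AN bV.
have -> : V = (nbhd_of A B `&` V) `|` (V `&` ~` nbhd_of A B).
  apply/seteqP; split=> x; last by case=> -[].
  by move=> Vx; case: (pselect (nbhd_of A B x)) => ?; [left|right].
apply: coarsely_disjoint_setUr; first exact: bounded_coarsely_disjointr.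
by apply: sub_coarsely_disjoint AN => // x [].
Qed.

Lemma bounded_nbhd_trace (X : metricType R) (Y N V : set X) :
  coarsely_disjoint (N `&` Y) V -> V `<=` Y -> bounded_subset (N `&` V).
Proof.
move=> /coarsely_disjoint_setI NV VY; apply: sub_bounded NV => x [Nx Vx].
by split=> //; split=> //; exact: VY.
Qed.

Lemma asInd_lt_setU_zero m (X : metricType R) (Y Z : set X) : proper_metric X ->
  closed Y -> closed Z -> Y `|` Z = setT ->
  asInd_lt 1 (set_type Y) -> asInd_lt m.+1 (set_type Z) -> asInd_lt m.+1 X.
Proof.
move=> pX clY clZ YZ dY dZ A B /asymp_disjointP AB.
have BA := coarsely_disjointC AB.
have [P [V1s [V2s [_ PY /metric_bounded_subset bP [V12 Vsplit VP [VA VB]]]]]] :=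
  subspace_separator pX clY dY (nbhd_of_disjoint AB).
have {}bP : bounded_subset P.
  have /bounded_set_val := bP; apply: sub_bounded => x Px.
  by exists (SigSub (mem_set Px)).
(* A bounded [P] is coarsely disjoint from everything, so [Y] itself can be split. *)
have [V1 [V2 [UV1 UV2 YV]]] := Vsplit Y (@subset_refl _ Y)
  (bounded_coarsely_disjointr Y bP).
have V1Y : V1 `<=` Y by case: (VP V1); [left|].
have V2Y : V2 `<=` Y by case: (VP V2); [right|].
pose A2 := A `|` V1; pose B2 := B `|` V2.
have AB2 : coarsely_disjoint A2 B2.
  apply: coarsely_disjoint_setUl; apply: coarsely_disjoint_setUr => //.
  - apply: (coarsely_disjoint_nbhd AB).
    exact: bounded_nbhd_trace (V12 _ _ VA UV2) V2Y.
  - apply/coarsely_disjointC/(coarsely_disjoint_nbhd BA).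
    exact: bounded_nbhd_trace (coarsely_disjointC (V12 _ _ UV1 VB)) V1Y.
  - exact: V12.
have BA2 := coarsely_disjointC AB2.
have [C [W1s [W2s [clC CZ dC [W12 Wsplit WC [WA WB]]]]]] :=
  subspace_separator pX clZ dZ (nbhd_of_disjoint AB2).
exists C; split=> //; apply/asymp_separatorP => //; split=> //.
have A2W W : W2s W -> coarsely_disjoint A2 W.
  move=> UW; apply: (coarsely_disjoint_nbhd AB2).
  by apply: bounded_nbhd_trace (W12 _ _ WA UW) _; case: (WC W); [right|].
have B2W W : W1s W -> coarsely_disjoint B2 W.
  move=> UW; apply: (coarsely_disjoint_nbhd BA2).
  apply: bounded_nbhd_trace (coarsely_disjointC (W12 _ _ UW WB)) _.
  by case: (WC W); [left|].
have A2C : coarsely_disjoint A2 C.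
  apply: (coarsely_disjoint_nbhd AB2); apply: bounded_nbhd_trace CZ.
  by case: (WC _ (or_introl WA)).
have B2C : coarsely_disjoint B2 C.
  apply: (coarsely_disjoint_nbhd BA2); apply: bounded_nbhd_trace CZ.
  by case: (WC _ (or_intror WB)).
exists [set V | exists2 W, W1s W & V `<=` W `|` A2].
exists [set V | exists2 W, W2s W & V `<=` W `|` B2].
split.
- move=> S1 S2 [Wa UWa sS1] [Wb UWb sS2].
  apply: sub_coarsely_disjoint sS1 sS2 _.
  apply: coarsely_disjoint_setUl; apply: coarsely_disjoint_setUr => //.
  + exact: W12.
  + exact/coarsely_disjointC/B2W.
  + exact: A2W.
- move=> V VC.
  have [||Wa [Wb [UWa UWb VW]]] := Wsplit (V `&` Z).
  + by move=> x [].
  + by apply: sub_coarsely_disjoint VC => // x [].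
  exists (Wa `|` A2), (Wb `|` B2); split; [by exists Wa|by exists Wb|].
  move=> x Vx; have [Yx|Zx] : (Y `|` Z) x by rewrite YZ.
    by case: (YV x Yx) => ?; [left|right]; right; right.
  by case: (VW x (conj Vx Zx)) => ?; [left|right]; left.
- by move=> V [] [W UW VW]; apply: sub_coarsely_disjoint VW (@subset_refl _ C) _;
    apply: coarsely_disjoint_setUl => //; case: (WC W) => //; [left|right].
- by exists (nbhd_of A2 B2 `&` Z) => // x Ax; right; left.
- by exists (nbhd_of B2 A2 `&` Z) => // x Bx; right; left.
Qed.

Lemma asInd_lt_setU n m (X : metricType R) (Y Z : set X) : proper_metric X ->
  closed Y -> closed Z -> Y `|` Z = setT ->
  asInd_lt n.+1 (set_type Y) -> asInd_lt m.+1 (set_type Z) ->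
  asInd_lt (n + m).+1 X.
Proof.
elim: n X Y Z => [|n IH] X Y Z pX clY clZ YZ dY dZ.
  exact: asInd_lt_setU_zero YZ dY dZ.
move=> A B /asymp_disjointP AB; have BA := coarsely_disjointC AB.
pose A0 := nbhd_of A B; pose B0 := nbhd_of B A.
have AB0 : coarsely_disjoint A0 B0 by exact: nbhd_of_disjoint.
have BA0 := coarsely_disjointC AB0.
have [P [U1 [U2 [clP PY dP [U12 Usplit UP [UA UB]]]]]] :=
  subspace_separator pX clY dY (nbhd_of_disjoint AB0).
(* The points of [Z] whose side is not fixed by [A0] or [B0] go into the separator. Closing this set
   leaves it inside [Z] and coarsely disjoint from [A] and [B]. *)
pose Q := closure (Z `\` (A0 `|` B0)).
have QZ : Q `<=` Z by rewrite (closure_id Z).1//; apply: closureS => x [].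
have clQ : closed Q by exact: closed_closure.
pose L := P `|` Q; have clL : closed L by exact: closedU.
have dL : asInd_lt (n + m).+1 (set_type L).
  apply: (IH _ (set_val @^-1` P) (set_val @^-1` Q)).
  - exact: proper_set_type.
  - by apply: closed_comp clP => x _; exact: initial_continuous.
  - by apply: closed_comp clQ => x _; exact: initial_continuous.
  - by apply/seteqP; split=> // x _; exact: (set_valP x).
  - exact: asInd_lt_preimage.
  - by apply: asInd_lt_preimage => //; exact: asInd_lt_subset dZ.
exists L; split; last by rewrite addSn.
apply/asymp_separatorP => //; split=> //.
have A0U V : U2 V -> coarsely_disjoint A0 V.
  move=> UV; apply: (coarsely_disjoint_nbhd AB0).
  by apply: bounded_nbhd_trace (U12 _ _ UA UV) _; case: (UP V); [right|].
have B0U V : U1 V -> coarsely_disjoint B0 V.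
  move=> UV; apply: (coarsely_disjoint_nbhd BA0).
  apply: bounded_nbhd_trace (coarsely_disjointC (U12 _ _ UV UB)) _.
  by case: (UP V); [left|].
have AL : coarsely_disjoint A L.
  apply: coarsely_disjoint_setUr.
    apply: (sub_coarsely_disjoint (@nbhd_of_sub _ _ A B) (@subset_refl _ P)).
    apply: (coarsely_disjoint_nbhd AB0); apply: bounded_nbhd_trace PY.
    by case: (UP _ (or_introl UA)).
  apply/coarsely_disjointC/coarsely_disjoint_closurel/coarsely_disjointC.
  apply: sub_coarsely_disjoint (nbhd_of_compl AB) => // x [_ nx] Ax.
  by apply: nx; left.
have BL : coarsely_disjoint B L.
  apply: coarsely_disjoint_setUr.
    apply: (sub_coarsely_disjoint (@nbhd_of_sub _ _ B A) (@subset_refl _ P)).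
    apply: (coarsely_disjoint_nbhd BA0); apply: bounded_nbhd_trace PY.
    by case: (UP _ (or_intror UB)).
  apply/coarsely_disjointC/coarsely_disjoint_closurel/coarsely_disjointC.
  apply: sub_coarsely_disjoint (nbhd_of_compl BA) => // x [_ nx] Bx.
  by apply: nx; right.
(* Points of [Y] are sorted by the splitting in [Y], points of [Z] by [A0] and [B0]. The remaining
   points of a [V] coarsely disjoint from [L] lie in [Q], so they form a bounded set [K]. *)
pose side (U : set (set X)) (T : set X) : set (set X) := [set V |
  coarsely_disjoint V L /\ exists W K, [/\ U W, bounded_subset K &
    V `<=` W `|` T `|` K]].
exists (side U1 A0), (side U2 B0); split.
- move=> V1 V2 [_ [W1 [K1 [UW1 bK1 sV1]]]] [_ [W2 [K2 [UW2 bK2 sV2]]]].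
  apply: sub_coarsely_disjoint sV1 sV2 _.
  apply: coarsely_disjoint_setUl; last exact: bounded_coarsely_disjointl.
  apply: coarsely_disjoint_setUr; last exact: bounded_coarsely_disjointr.
  apply: coarsely_disjoint_setUl; apply: coarsely_disjoint_setUr => //.
  + exact: U12.
  + exact/coarsely_disjointC/B0U.
  + exact: A0U.
- move=> V VL.
  have [||W1 [W2 [UW1 UW2 VW]]] := Usplit (V `&` Y).
  + by move=> x [].
  + by apply: sub_coarsely_disjoint VL => [x []|x]; last left.
  have bVQ : bounded_subset (V `&` Q).
    by apply: sub_bounded (coarsely_disjoint_setI VL) => x [Vx Qx]; split=> //; right.
  have VQL (T : set X) : coarsely_disjoint (V `&` T) L.
    by apply: sub_coarsely_disjoint VL => // x [].
  exists (V `&` (W1 `|` A0 `|` (V `&` Q))), (V `&` (W2 `|` B0 `|` (V `&` Q))).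
  split.
  + by split=> //; exists W1, (V `&` Q); split=> // x [].
  + by split=> //; exists W2, (V `&` Q); split=> // x [].
  + move=> x Vx; have [Yx|Zx] : (Y `|` Z) x by rewrite YZ.
      by case: (VW x (conj Vx Yx)) => ?; [left|right]; split=> //; left; left.
    case: (pselect (A0 x)) => [?|nA]; first by left; split=> //; left; right.
    case: (pselect (B0 x)) => [?|nB]; first by right; split=> //; left; right.
    left; split=> //; right; split=> //; apply: subset_closure; split=> //.
    by case.
- by move=> V [] [].
- split=> //; exists (nbhd_of A0 B0 `&` Y), set0; split=> //; first exact: bounded_set0.
  by move=> x Ax; left; right; exact: nbhd_of_sub.
- split=> //; exists (nbhd_of B0 A0 `&` Y), set0; split=> //; first exact: bounded_set0.
  by move=> x Bx; left; right; exact: nbhd_of_sub.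
Qed.

(** * Passage from [asInd_lt] to [asInd] *)

Lemma succn_sub1 (k : nat) : k.+1%:Z - 1 = k%:Z.
Proof. by rewrite intS addrAC subrr add0r. Qed.

Lemma asInd_leP (X : metricType R) (n : int) : proper_metric X ->
  asInd_le X n -> exists2 k : nat, asInd_lt k X & n = k%:Z - 1.
Proof.
case: n => [k|[|//]] pX dX; first by exists k.+1 => //; rewrite succn_sub1.
by exists 0.
Qed.

Lemma asInd_le_lt (X : metricType R) (k : nat) :
  asInd_le X (k%:Z - 1) <-> asInd_lt k X.
Proof.
case: k => [|k]; first by rewrite sub0r.
by rewrite succn_sub1.
Qed.

Lemma asInd_eqP (X : metricType R) (k : nat) : proper_metric X ->
  asInd_lt k X -> (forall j, (j < k)%N -> ~ asInd_lt j X) ->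
  asInd X = (k%:Z - 1)%:E.
Proof.
move=> pX dX nX; rewrite /asInd; apply: xget_unique.
  exists (k%:Z - 1) => //; split; first exact/asInd_le_lt.
  (* For [k = 0] the condition to refute is [asInd_le X (-2)], false by definition. *)
  case: k dX nX => [_ _ []|k dX nX]; rewrite succn_sub1.
  by move/asInd_le_lt; exact: nX.
move=> _ [n [/(asInd_leP pX)[j dj ->] nj] <-]; congr (_ - 1)%:E; congr Posz.
apply/eqP; rewrite eqn_leq; apply/andP; split.
  rewrite leqNgt; apply/negP => kj; apply: nj.
  case: j dj kj => [//|j] dj kj; rewrite succn_sub1.
  by apply/asInd_le_lt; exact: asInd_lt_leq dX.
by rewrite leqNgt; apply/negP => /nX.
Qed.

Lemma asInd_le_of_lt (X : metricType R) (k : nat) : proper_metric X ->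
  asInd_lt k X -> (asInd X <= (k%:Z - 1)%:E)%E.
Proof.
move=> pX dX.
have exk : exists j, `[< asInd_lt j X >] by exists k; exact/asboolP.
case: (ex_minnP exk) => j /asboolP dj minj.
rewrite (asInd_eqP pX dj); last first.
  by move=> i ij /asboolP/minj; rewrite leqNgt ij.
by rewrite lee_fin lerB// lez_nat; apply: minj; exact/asboolP.
Qed.

(** [+oo] is the default of [xget], and unboundedness excludes the value -1; this supplies the
    successor indices that [asInd_lt_setU] asks for. *)
Lemma asInd_unbounded (X : metricType R) : proper_metric X ->
  ~ metric_bounded X ->
  asInd X = +oo%E \/ exists2 k : nat, asInd X = k%:Z%:E & asInd_lt k.+1 X.
Proof.
move=> pX nX; rewrite /asInd; case: xgetP => [y -> [n [dn _] <-]|]; last by left.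
by case: n dn => [k|[|//]] dn; [right; exists k|].
Qed.

End addition.

Local Close Scope ring_scope.

Theorem theorem3 (R : realType) (X : metricType R) (hX : proper_metric X)
    (Y Z : set X) (hYZ : Y `|` Z = setT)
    (clY : closed Y) (clZ : closed Z)
    (unbY : ~ metric_bounded (set_type Y))
    (unbZ : ~ metric_bounded (set_type Z)) :
  (asInd X <= asInd (set_type Y) + asInd (set_type Z))%E.
Proof.
have [-> | [n -> dY]] := asInd_unbounded (proper_set_type clY hX) unbY.
  have [-> | [m -> _]] := asInd_unbounded (proper_set_type clZ hX) unbZ; exact: leey.
have [-> | [m -> dZ]] := asInd_unbounded (proper_set_type clZ hX) unbZ.
  exact: leey.
have := asInd_le_of_lt hX (asInd_lt_setU hX clY clZ hYZ dY dZ).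
by rewrite succn_sub1 PoszD.
Qed.
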